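(* Let $L \in \mathbb{R}^{n\times n}$ be negative semidefinite, $B \in \mathbb{R}^{n\times n}$, $X_0 \in \mathbb{R}^n$, $t \in [0,1]$, and let $m \ge 2$ be an integer. Let $X_t$ be the solution of $dX_t = L X_t\,dt + B\,dW_t$ with initial value $X_0$, and let $X_t^m$ be the approximation $$X_t^m = e^{tL}X_0 + \sqrt{2}\sum_{k=1}^m \varphi_{k,t}^{\cos}(L)\,B\,Z_k .$$ Then $$\mathbb{E}\|X_t\|^2 - \mathbb{E}\|X_t^m\|^2 = 2\sum_{k=m+1}^\infty \left\|\varphi_{k,t}^{\cos}(L)B\right\|_F^2 \le \frac{2\|B\|^2}{\pi^2}\,\frac{n}{m-1}.$$
   Context: A matrix $L\in\mathbb{R}^{n\times n}$ is called negative semidefinite if its numerical range $\{x^*Lx : x\in\mathbb{C}^n, \|x\|_2=1\}$ is contained in $\mathbb{R}_{\le 0}$ (so $L$ is symmetric). $\|\cdot\|$ is the Euclidean norm on vectors and the induced spectral norm on matrices; $\|\cdot\|_F$ is the Frobenius norm. $W_t$ is a standard $n$-dimensional Wiener process with Karhunen--Lo\`eve expansion $W_t = \sqrt{2}\sum_{k=1}^\infty Z_k \frac{\sin(\lambda_k t)}{\lambda_k}$ for $t\in[0,1]$ (convergence in $L^2$), where $\lambda_k = (k-\tfrac12)\pi$ and $Z_1,Z_2,\dots$ are independent $\mathbb{R}^n$-valued random vectors whose components are all independent $\mathcal{N}(0,1)$ random variables. The same $Z_k$ are used in the definition of $X_t^m$. The solution of the stochastic differential equation is $X_t = e^{tL}X_0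 + \int_0^t e^{(t-s)L}B\,dW_s$ (It\^o integral). The function $\varphi_{k,t}^{\cos}$ is the entire function $\varphi_{k,t}^{\cos}(z) = \int_0^t e^{(t-s)z}\cos(\lambda_k s)\,ds = \frac{z e^{zt} - z\cos(\lambda_k t)+\lambda_k\sin(\lambda_k t)}{z^2+\lambda_k^2}$, and $\varphi_{k,t}^{\cos}(L)$ is the corresponding matrix function, i.e. $\varphi_{k,t}^{\cos}(L)=\int_0^t e^{(t-s)L}\cos(\lambda_k s)\,ds$. *)

(* Defs.v *)
From HB Require Import structures.
From mathcomp Require Import all_boot all_order all_algebra.
From mathcomp Require Import finmap.
From mathcomp Require Import all_classical all_reals all_analysis.
From mathcomp Require Import complex.

Set Implicit Arguments.
Unset Strict Implicit.
Unset Printing Implicit Defensive.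

Import Order.TTheory GRing.Theory Num.Theory.
Import numFieldNormedType.Exports.

Local Open Scope classical_set_scope.
Local Open Scope ring_scope.

Section Matrices.
Context {R : realType} {n : nat}.
Implicit Types (A L : 'M[R]_n) (x : 'cV[R]_n).

(* The norm `| _ | that the library puts on matrices and vectors is the
   entrywise supremum, so the three norms needed here are defined separately. *)
Definition enorm x : R := Num.sqrt (\sum_(i < n) x i 0 ^+ 2).

Definition spectral_norm A : R :=
  sup [set enorm (A *m x) | x in [set x : 'cV[R]_n | enorm x <= 1]].

Definition frobenius_norm A : R :=
  Num.sqrt (\sum_(i < n) \sum_(j < n) A i j ^+ 2).

Definition numerical_range L : set R[i] :=
  [set ((map_mx (@conjc R) x)^T *m map_mx (real_complex R) L *m x) 0 0
   | x in [set x : 'cV[R[i]]_n | \sum_(i < n) `|x i 0| ^+ 2 = 1]].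

(* Containment in the real half-line makes the quadratic form real on complex
   vectors; this is what forces L to be symmetric. *)
Definition negative_semidefinite L : Prop :=
  numerical_range L `<=` [set real_complex R r | r in [set r : R | r <= 0]].

Definition expm A : 'M[R]_n :=
  limn (series (fun k => (k`!%:R : R)^-1 *: A ^+ k)).

End Matrices.

Section Frequencies.
Context {R : realType}.

Definition freq (k : nat) : R := (k%:R - 2^-1) * pi.

Definition phi_cos n (k : nat) (t : R) (L : 'M[R]_n) : 'M[R]_n :=
  \matrix_(i, j) \int[lebesgue_measure]_(s in `[0, t])
    (expm ((t - s) *: L) i j * cos (freq k * s)).

End Frequencies.

Section RandomVectors.
Context {d : measure_display} {T : measurableType d} {R : realType}.
Variable P : probability T R.

Definition random_vector n (X : T -> 'cV[R]_n) : Prop :=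
  forall i, measurable_fun setT (fun w => X w i 0).

Definition mutually_independent (I : choiceType) (D : set I) (X : I -> T -> R)
    : Prop :=
  forall (J : {fset I}) (C : I -> set R),
    [set` J] `<=` D -> (forall i, measurable (C i)) ->
    (P (\bigcap_(i in [set` J]) X i @^-1` C i)
     = \prod_(i <- J) P (X i @^-1` C i))%E.

(* Only the indices k >= 1 are constrained, Z 0 is irrelevant. *)
Definition iid_standard_normal n (Z : nat -> T -> 'cV[R]_n) : Prop :=
  [/\ forall k, (0 < k)%N -> random_vector (Z k),
      mutually_independent [set p : nat * 'I_n | (0 < p.1)%N]
        (fun p w => Z p.1 w p.2 0)
    & forall k i (C : set R), (0 < k)%N -> measurable C ->
        P ((fun w => Z k w i 0) @^-1` C) = normal_prob 0 1 C].

End RandomVectors.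

Section Wiener.
Context {d : measure_display} {T : measurableType d} {R : realType}.
Variables (P : probability T R) (F : R -> set (set T)).

Definition filtration : Prop :=
  (forall u : R, u \in `[0, 1] -> sigma_algebra setT (F u) /\
     F u `<=` measurable) /\
  (forall s u : R, 0 <= s -> s <= u -> u <= 1 -> F s `<=` F u).

Definition measurable_wrt (G : set (set T)) (X : T -> R) : Prop :=
  forall C : set R, measurable C -> G (X @^-1` C).

(* The last clause says at once that W u - W s is independent of F s and has
   the law N(0, (u - s) I_n); the second argument of normal_prob is the
   standard deviation. *)
Definition wiener_process n (W : R -> T -> 'cV[R]_n) : Prop :=
  [/\ forall (u : R) i, u \in `[0, 1] -> measurable_wrt (F u) (fun w => W u w i 0),
      {ae P, forall w, W 0 w = 0},
      {ae P, forall w, forall i, {within `[0, 1], continuous (fun u : R => W u w i 0)}}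
    & forall (s u : R) (A : set T) (C : 'I_n -> set R),
        0 <= s -> s < u -> u <= 1 -> F s A -> (forall i, measurable (C i)) ->
        (P (A `&` \bigcap_i (fun w => (W u w - W s w) i 0)%R @^-1` C i)
         = P A * \prod_(i < n) normal_prob 0%R (Num.sqrt (u - s))%R (C i))%E].

Record simple_process (n : nat) (t : R) := SimpleProcess {
  sp_size : nat;
  sp_time : nat -> R;
  sp_coef : nat -> T -> 'M[R]_n;
  sp_time0 : sp_time 0%N = 0;
  sp_timeN : sp_time sp_size = t;
  sp_time_le : forall j, (j < sp_size)%N -> sp_time j <= sp_time j.+1;
  sp_adapted : forall j a b, (j < sp_size)%N ->
    measurable_wrt (F (sp_time j)) (fun w => sp_coef j w a b);
  sp_bounded : exists M : R, forall j a b w, (j < sp_size)%N ->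
    `|sp_coef j w a b| <= M }.

Definition sp_eval n t (H : simple_process n t) (u : R) (w : T) : 'M[R]_n :=
  \sum_(j < sp_size H | sp_time H j < u <= sp_time H j.+1) sp_coef H j w.

Definition sp_integral n t (H : simple_process n t) (W : R -> T -> 'cV[R]_n)
    (w : T) : 'cV[R]_n :=
  \sum_(j < sp_size H)
    sp_coef H j w *m (W (sp_time H j.+1) w - W (sp_time H j) w).

(* J is (a version of) the Ito integral of H over [0, t] with respect to W:
   simple processes converge to H in L^2([0, t] x Omega) and their integrals
   converge to J in L^2(Omega). *)
Definition is_ito_integral n (W : R -> T -> 'cV[R]_n) (t : R)
    (H : R -> T -> 'M[R]_n) (J : T -> 'cV[R]_n) : Prop :=
  random_vector J /\
  exists S : nat -> simple_process n t,
    (\int[lebesgue_measure]_(u in `[0%R, t])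
        'E_P[fun w => (frobenius_norm (sp_eval (S N) u w - H u w) ^+ 2)%R]
       @[N --> \oo] --> 0)%E /\
    ('E_P[fun w => (enorm (sp_integral (S N) W w - J w) ^+ 2)%R]
       @[N --> \oo] --> 0)%E.

(* Solution of dX = L X dt + B dW on [0, 1] with initial value X0, given by
   variation of constants. *)
Definition linear_sde_solution n (W : R -> T -> 'cV[R]_n) (L B : 'M[R]_n)
    (X0 : 'cV[R]_n) (X : R -> T -> 'cV[R]_n) : Prop :=
  forall t : R, t \in `[0, 1] ->
    is_ito_integral W t (fun s _ => expm ((t - s) *: L) *m B)
      (fun w => X t w - expm (t *: L) *m X0).

(* Convergence of the partial sums in L^2(Omega), at each fixed time. *)
Definition karhunen_loeve n (W : R -> T -> 'cV[R]_n) (Z : nat -> T -> 'cV[R]_n)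
    : Prop :=
  forall t : R, t \in `[0, 1] ->
    ('E_P[fun w => (enorm (W t w - Num.sqrt 2 *:
        \sum_(1 <= k < N.+1) (sin (freq k * t) / freq k) *: Z k w) ^+ 2)%R]
       @[N --> \oo] --> 0)%E.

End Wiener.

Definition kl_approx {T : Type} {R : realType} n (L B : 'M[R]_n)
    (X0 : 'cV[R]_n) (Z : nat -> T -> 'cV[R]_n) (m : nat) (t : R) (w : T)
    : 'cV[R]_n :=
  expm (t *: L) *m X0 +
  Num.sqrt 2 *: \sum_(1 <= k < m.+1) phi_cos k t L *m B *m Z k w.

(* Main.v *)
From HB Require Import structures.
Require Import Defs.
From mathcomp Require Import all_boot all_order all_algebra finmap.
From mathcomp Require Import ring lra.
From mathcomp Require Import all_classical all_reals all_analysis measurable_realfun.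
From mathcomp Require Import complex.

Set Implicit Arguments.
Unset Strict Implicit.
Unset Printing Implicit Defensive.

Import Order.TTheory GRing.Theory Num.Theory.
Import numFieldNormedType.Exports.

Local Open Scope classical_set_scope.
Local Open Scope ring_scope.

(** The difference X_t - e^(tL) X_0 is an Ito integral J of the deterministic
    integrand h(u) = e^((t-u)L) B, and everything rests on the expansion
      J = sum_(k >= 1) c_k Z_k  in mean square,  c_k = sqrt 2 * phi_k(L) B
    [ito_chaos].  The integral J is only given as a limit of integrals of adapted
    simple processes S_N.  Replacing each coefficient of S_N by its expectation
    changes the integral by a quantity whose second moment is, by the Ito
    isometry [ito_isometry], the variance part of the mean-square distance from
    S_N to h [expect_sp_eval]; hence J is also the limit of integrals of
    deterministic step functions.  Such an integral is a finite linear
    combination of values W_s, so the Karhunen-Loeve series expands it in the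
    Z_k, with coefficients sqrt 2 * int S_N(u) cos(lambda_k u) du
    [step_int_chaos].  These converge to c_k because S_N converges to h in L^2
    [sp_coef_le], and an l^2 argument in the orthonormal family Z_k passes the
    expansion to the limit [chaos_limit].  By orthonormality the second moment of
    X_t^m is |e^(tL) X_0|^2 + 2 sum_(k <= m) |phi_k(L) B|_F^2, that of X_t is its
    limit as m grows, and the difference is the tail of the series
    [moment2_error].

    For the bound, L is symmetric and is diagonalized by a real matrix Q with
    Q^T Q = 1 [real_spectral], which gives
      |phi_k(L) B|_F^2 = sum_a phi_k(d_a)^2 |row a of Q B|^2
    with d_a <= 0 [frobenius_phi_cos].  The squared row norms add up to
    |B|_F^2, which is at most n times the squared spectral norm of B, so it is
    enough to prove, for all x, t >= 0 and m >= 2,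
      sum_(k > m) phi_k(-x)^2 <= 1 / (pi^2 (m - 1))
    [sum_sphi_le].  Here phi_k(-x) = (x cos th + lambda sin th - a) / (x^2 + lambda^2)
    with lambda = lambda_k, th = lambda_k t and a = x e^(-xt) <= 1 / (2t).
    Expanding the square gives the term bound 1/lambda^2 + 2a/lambda^3, which
    telescopes to the claim as long as pi t >= 1/2.  For smaller t the second
    term is too large.  While th <= pi one has sin th >= 0, and then
    1/lambda^2 alone is a bound.  From there on the oscillation of th is slow
    enough to be summed by parts: it removes part of the leading term, leaving
    (9/16)/lambda^2, and the gain pays for the terms in 1/lambda^3 and for the
    boundary terms of the summation. *)

(** * Elementary inequalities for sine, cosine and the exponential *)

Section Trigo.
Context {R : realType}.
Implicit Types x y t : R.

Lemma sin_mvt y : 0 <= y -> exists2 c, 0 <= c <= y & sin y = cos c * y.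
Proof.
rewrite le_eqVlt => /orP[/eqP <-|y0].
  by exists 0; rewrite ?sin0 ?mulr0 ?lexx.
have [c cy] := @MVT R sin cos 0 y y0 (fun x _ => is_derive_sin x)
  (continuous_subspaceT (@continuous_sin R)).
rewrite sin0 !subr0 => H; exists c => //.
by move: cy; rewrite in_itv/= => /andP[/ltW -> /ltW ->].
Qed.

(** By the double angle formula 1 - cos y = 2 sin^2 (y/2), and sin z <= z. *)
Lemma cos_ge_quad y : 0 <= y -> 1 - y ^+ 2 / 2 <= cos y.
Proof.
move=> y0; rewrite [in leRHS](_ : y = (y / 2) *+ 2); last by rewrite -mulr_natr divfK.
rewrite cos_mulr2n cos2sin2.
have [|c _ ->] := @sin_mvt (y / 2); first lra.
have : cos c ^+ 2 <= 1 by rewrite cos2sin2; have := sqr_ge0 (sin c); lra.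
by have := sqr_ge0 y; rewrite !exprMn; nra.
Qed.

Lemma sin_ge_id y : 0 <= y <= 2^-1 -> 7 / 8 * y <= sin y.
Proof.
move=> /andP[y0 y1]; have [c /andP[c0 c1] ->] := sin_mvt y0.
by rewrite ler_wpM2r//; have := cos_ge_quad c0; nra.
Qed.

(** The quadratic minorant of cos is positive at 7/5, so 7/5 < pi/2.  This
    precision is what the numerical margin in [sum_sphi_small] requires. *)
Lemma pi_ge28 : 28 / 10 <= pi :> R.
Proof.
rewrite leNgt; apply/negP => h.
have c14 : 0 < cos (14 / 10 : R).
  have -> : (14 / 10 : R) = (7/10) *+ 2 by lra.
  rewrite cos_mulr2n.
  have := @cos_ge_quad (7/10); nra.
have : cos (14 / 10 : R) < cos (pi / 2).
  rewrite ltr_cos ?in_itv/=; have := pi_ge2 R; lra.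
by rewrite cos_pihalf; lra.
Qed.

(** e^x >= (1 + x/2)^2 >= 2x; applied to xt it bounds x e^(-xt) by 1/(2t)
    uniformly in x. *)
Lemma expRN_le x : 0 <= x -> x * expR (- x) <= 2^-1.
Proof.
move=> x0; rewrite expRN ler_pdivrMr ?expR_gt0//.
have -> : expR x = expR (x / 2) ^+ 2 by rewrite -expRM_natl mulr_natl -mulr_natr divfK.
have := expR_ge1Dx (x / 2) => h.
have : (1 + x / 2) ^+ 2 <= expR (x / 2) ^+ 2.
  by rewrite lerXn2r ?nnegrE ?expR_ge0//; lra.
have : 0 <= (1 - x / 2) ^+ 2 by exact: sqr_ge0.
by nra.
Qed.

End Trigo.

(** * Algebraic bounds on one term of the scalar series *)

(** In this part (c, s) stands for the cosine and sine of the angle lambda t, l for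
    the frequency lambda and a for x e^(-xt), which lies between 0 and x. *)
Section Algebraic.
Context {R : realFieldType}.
Implicit Types x l a c s : R.

Lemma resolvent_gt0 x l : 0 < l -> 0 < x ^+ 2 + l ^+ 2.
Proof. by move=> l0; have := sqr_ge0 x; have := exprn_gt0 2 l0; lra. Qed.

Lemma proj_sqr_le x l c s : c ^+ 2 + s ^+ 2 = 1 -> (x * c + l * s) ^+ 2 <= x ^+ 2 + l ^+ 2.
Proof.
move=> cs; rewrite -[leRHS]mulr1 -cs -subr_ge0.
rewrite (_ : _ - _ = (x * s - l * c) ^+ 2); first exact: sqr_ge0.
ring.
Qed.

Lemma cross_term_le x l a c s : 0 < l -> 0 <= a -> c ^+ 2 + s ^+ 2 = 1 ->
  - (2 * a * (x * c + l * s)) / (x ^+ 2 + l ^+ 2) ^+ 2 <= 2 * a / l ^+ 3.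
Proof.
move=> l0 a0 cs; have r0 := resolvent_gt0 x l0.
rewrite ler_pdivrMr ?exprn_gt0// [leRHS]mulrAC ler_pdivlMr ?exprn_gt0//.
have h := proj_sqr_le x l cs; set u := x * c + _ in h *.
set r := x ^+ 2 + _ in h r0 *.
have lr : l ^+ 2 <= r by have := sqr_ge0 x; rewrite /r; lra.
have h2 : - u * l <= r by have := sqr_ge0 (u + l); nra.
have l2 : 0 <= l ^+ 2 by exact: sqr_ge0.
rewrite [leLHS](_ : _ = 2 * a * ((- u * l) * l ^+ 2)); last by ring.
rewrite ler_wpM2l//; first lra.
apply: (@le_trans _ _ (r * l ^+ 2)); first by rewrite ler_wpM2r.
by rewrite [leRHS]expr2 ler_wpM2l// ltW.
Qed.

(** Expand the square: u^2 <= x^2 + l^2 by Cauchy-Schwarz for u = x c + l s, the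
    term a^2 <= x^2 fits into the remaining room, and the cross term is at most
    2a/l^3.  As a is controlled by 1/(2t) only, this is of use when t is not small. *)
Lemma phi_sqr_le_cubic x l a c s : 0 < l -> 0 <= a <= x -> c ^+ 2 + s ^+ 2 = 1 ->
  ((x * c + l * s - a) / (x ^+ 2 + l ^+ 2)) ^+ 2 <= (l ^+ 2)^-1 + 2 * a / l ^+ 3.
Proof.
move=> l0 /andP[a0 ax] cs; have r0 := resolvent_gt0 x l0.
have H1 := cross_term_le x l0 a0 cs; have h := proj_sqr_le x l cs.
set u := x * c + l * s in H1 h *; rewrite exprMn exprVn.
rewrite [X in X / _](_ : _ = (u ^+ 2 + a ^+ 2) + - (2 * a * u)); last by ring.
rewrite mulrDl lerD// ler_pdivrMr ?exprn_gt0// [leRHS]mulrC ler_pdivlMr ?exprn_gt0//.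
have : a ^+ 2 <= x ^+ 2 by nra.
have := sqr_ge0 l; have := sqr_ge0 (x ^+ 2) => xx ll aa.
apply: (@le_trans _ _ ((x ^+ 2 + l ^+ 2 + x ^+ 2) * l ^+ 2)).
  by rewrite ler_wpM2r//; lra.
by nra.
Qed.

(** With s >= 0 a negative numerator is at least -x - a >= -2x, and
    (2 x l)^2 <= (x^2 + l^2)^2; a nonnegative one only decreases when a is
    subtracted. *)
Lemma phi_sqr_le_sin x l a c s : 0 < l -> 0 <= a <= x -> c ^+ 2 + s ^+ 2 = 1 -> 0 <= s ->
  ((x * c + l * s - a) / (x ^+ 2 + l ^+ 2)) ^+ 2 <= (l ^+ 2)^-1.
Proof.
move=> l0 /andP[a0 ax] cs s0; have r0 := resolvent_gt0 x l0.
have h := proj_sqr_le x l cs.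
rewrite exprMn exprVn ler_pdivrMr ?exprn_gt0// [leRHS]mulrC ler_pdivlMr ?exprn_gt0//.
have l2 : 0 <= l ^+ 2 by exact: sqr_ge0.
have x2 : 0 <= x ^+ 2 by exact: sqr_ge0.
have [u0|u0] := leP 0 (x * c + l * s - a).
  apply: (@le_trans _ _ ((x ^+ 2 + l ^+ 2) * l ^+ 2)); last by nra.
  by rewrite ler_wpM2r//; nra.
have c1 : -1 <= c by nra.
have ls : 0 <= l * s by rewrite mulr_ge0// ltW.
apply: (@le_trans _ _ ((2 * x) ^+ 2 * l ^+ 2)); last first.
  by have := sqr_ge0 (x ^+ 2 - l ^+ 2); nra.
rewrite ler_wpM2r//; nra.
Qed.

(** Write u^2 = (x^2 + l^2)/2 minus half of a trigonometric term in the double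
    angle, which is kept exactly because it cancels on summation.  The constant
    9/16 is the maximum over x of ((x^2 + l^2)/2 + x^2) l^2 / (x^2 + l^2)^2,
    reached at l^2 = 3 x^2. *)
Lemma phi_sqr_le_osc x l a c s : 0 < l -> 0 <= a <= x -> c ^+ 2 + s ^+ 2 = 1 ->
  ((x * c + l * s - a) / (x ^+ 2 + l ^+ 2)) ^+ 2 <=
  9 / 16 / l ^+ 2 + 2 * a / l ^+ 3 -
  2^-1 * ((l ^+ 2 - x ^+ 2) * (c ^+ 2 - s ^+ 2) - 2 * l * x * (2 * c * s))
     / (x ^+ 2 + l ^+ 2) ^+ 2.
Proof.
move=> l0 /andP[a0 ax] cs; have r0 := resolvent_gt0 x l0.
have H1 := cross_term_le x l0 a0 cs.
set u := x * c + l * s in H1 *; rewrite exprMn exprVn.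
set r := x ^+ 2 + _ in H1 r0 *.
rewrite [X in X / _ <= _](_ : _ = (u ^+ 2 + a ^+ 2) + - (2 * a * u)); last by ring.
rewrite mulrDl addrAC lerD//.
have -> : u ^+ 2 = 2^-1 * r - 2^-1 * ((l ^+ 2 - x ^+ 2) * (c ^+ 2 - s ^+ 2) - 2 * l * x * (2 * c * s)).
  rewrite (_ : r = r * (c ^+ 2 + s ^+ 2)); last by rewrite cs mulr1.
  by rewrite /r /u; field.
rewrite addrAC mulrDl mulNr -[_ * _ / r ^+ 2]mulrA lerB// ?mulrA//.
rewrite ler_pdivrMr ?exprn_gt0// [leRHS]mulrAC ler_pdivlMr ?exprn_gt0//.
have aa : a ^+ 2 <= x ^+ 2 by nra.
have l2 : 0 <= l ^+ 2 by exact: sqr_ge0.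
apply: (@le_trans _ _ ((2^-1 * r + x ^+ 2) * l ^+ 2)).
  by rewrite ler_wpM2r//; lra.
have := sqr_ge0 (l ^+ 2 - 3 * x ^+ 2); rewrite /r; nra.
Qed.

Lemma dot_le (p q S C v : R) : S ^+ 2 + C ^+ 2 = 1 -> 0 <= v ->
  p ^+ 2 + q ^+ 2 <= v ^+ 2 -> p * S + q * C <= v.
Proof.
move=> SC v0 h; apply: le_trans (ler_norm _) _.
rewrite -(@ler_pXn2r _ 2%N) ?nnegrE ?normr_ge0// real_normK ?num_real//.
apply: le_trans h.
by rewrite -[leRHS]mulr1 -SC; have := sqr_ge0 (p * C - q * S); nra.
Qed.

(** The real and imaginary parts of 1/(l - i x)^2, the complex amplitude of the
    double-angle term in [phi_sqr_le_osc]. *)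
Definition inv_sqr_re x l := (l ^+ 2 - x ^+ 2) / (x ^+ 2 + l ^+ 2) ^+ 2.
Definition inv_sqr_im x l := 2 * l * x / (x ^+ 2 + l ^+ 2) ^+ 2.
Local Notation g := inv_sqr_re.
Local Notation h := inv_sqr_im.

(** |1/(l - i x)^2| = 1/(x^2 + l^2). *)
Lemma osc_norm x l : 0 < l -> g x l ^+ 2 + h x l ^+ 2 <= ((l ^+ 2)^-1) ^+ 2.
Proof.
move=> l0; have r0 := resolvent_gt0 x l0.
have -> : g x l ^+ 2 + h x l ^+ 2 = ((x ^+ 2 + l ^+ 2) ^- 1) ^+ 2.
  by rewrite /inv_sqr_re /inv_sqr_im; field; rewrite gt_eqF.
rewrite lerXn2r ?nnegrE ?invr_ge0 ?(ltW r0) ?sqr_ge0//.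
by rewrite lef_pV2 ?posrE ?exprn_gt0//; have := sqr_ge0 x; lra.
Qed.

(** The derivative of s |-> 1/(s - i x)^2 is bounded by that of -1/s^2, so
    the amplitude varies no more than it does at x = 0.  The inequality is proved
    algebraically, after clearing denominators. *)
Lemma osc_diff x l l' : 0 < l -> l <= l' ->
  (g x l' - g x l) ^+ 2 + (h x l' - h x l) ^+ 2 <= ((l ^+ 2)^-1 - (l' ^+ 2)^-1) ^+ 2.
Proof.
move=> l0 ll'; have l'0 : 0 < l' by lra.
have r0 := resolvent_gt0 x l0; have r'0 := resolvent_gt0 x l'0.
set r := x ^+ 2 + l ^+ 2 in r0 *; set r' := x ^+ 2 + l' ^+ 2 in r'0 *.
have -> : (g x l' - g x l) ^+ 2 + (h x l' - h x l) ^+ 2 =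
   (l' - l) ^+ 2 * ((l + l') ^+ 2 + 4 * x ^+ 2) / (r * r') ^+ 2.
  by rewrite /inv_sqr_re /inv_sqr_im -/r -/r' /r /r'; field; rewrite !gt_eqF.
have -> : ((l ^+ 2)^-1 - (l' ^+ 2)^-1) ^+ 2 =
   (l' - l) ^+ 2 * (l + l') ^+ 2 / ((l * l') ^+ 2) ^+ 2.
  by field; rewrite !gt_eqF.
rewrite -[leLHS]mulrA -[leRHS]mulrA; apply: ler_wpM2l; first exact: sqr_ge0.
rewrite ler_pdivrMr ?exprn_gt0 ?mulr_gt0// [leRHS]mulrAC ler_pdivlMr ?exprn_gt0 ?mulr_gt0//.
rewrite /r /r' => {r r' r0 r'0}.
have x2 := sqr_ge0 x; have := exprn_gt0 2 l0; have := exprn_gt0 2 l'0.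
have : 0 < l * l' by rewrite mulr_gt0.
have -> : (l + l') ^+ 2 = l ^+ 2 + l' ^+ 2 + 2 * (l * l') by ring.
rewrite !exprMn.
move: (x ^+ 2) (l ^+ 2) (l' ^+ 2) (l * l') x2 => X p q w X0 w0 q0 p0.
have pq : 0 < p * q by rewrite mulr_gt0.
have H : (p * q) ^+ 2 + 2 * X * (p * q) * (p + q) <= ((X + p) * (X + q)) ^+ 2.
  have -> : (X + p) * (X + q) = X ^+ 2 + X * (p + q) + p * q by ring.
  have : 0 <= X * (p + q) by rewrite mulr_ge0//; lra.
  have := sqr_ge0 X; nra.
rewrite -exprMn.
apply: (@le_trans _ _ ((p + q + 2 * w) * ((p * q) ^+ 2 + 2 * X * (p * q) * (p + q)))); last first.
  by rewrite ler_wpM2l//; lra.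
rewrite mulrDl mulrDr lerD//.
have -> : 4 * X * (p * q) ^+ 2 = (2 * X * (p * q)) * (2 * (p * q)) by ring.
have -> : (p + q + 2 * w) * (2 * X * (p * q) * (p + q)) = (2 * X * (p * q)) * ((p + q + 2 * w) * (p + q)) by ring.
rewrite ler_wpM2l//; first by rewrite !mulr_ge0// ltW.
nra.
Qed.

End Algebraic.

(** * The scalar tail sum *)

Section ScalarBound.
Context {R : realType}.
Implicit Types x t : R.

(** The value at -x of the function z |-> int_0^t e^((t-s)z) cos(lambda_k s) ds
    (see [Rintegral_exp_cos]). *)
Definition sphi x (k : nat) t : R :=
  (x * cos (freq k * t) + freq k * sin (freq k * t) - x * expR (- (x * t)))
  / (x ^+ 2 + freq k ^+ 2).

Lemma freq_gt0 k : (0 < k)%N -> 0 < freq k :> R.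
Proof.
move=> k0; rewrite /freq mulr_gt0 ?pi_gt0//.
suff : 1 <= k%:R :> R by lra.
by rewrite ler1n.
Qed.

Lemma freqS k : freq k.+1 = freq k + pi :> R.
Proof. by rewrite /freq -natr1; ring. Qed.

(** lambda_k = (k - 1/2) pi and (k - 1/2)^2 >= k (k - 1). *)
Lemma inv_freq2_le k : (2 <= k)%N ->
  (freq k ^+ 2)^-1 <= (pi ^+ 2)^-1 * ((k.-1%:R)^-1 - (k%:R)^-1) :> R.
Proof.
case: k => [//|k] k0; rewrite -pred_Sn /freq exprMn invfM [leLHS]mulrC.
have p0 := pi_gt0 R; rewrite ler_wpM2l ?invr_ge0 ?sqr_ge0// -natr1.
have : 1 <= k%:R :> R by rewrite ler1n.
move: (k%:R) => q q1.
have -> : q^-1 - (q + 1)^-1 = (q * (q + 1))^-1 by field; lra.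
by rewrite lef_pV2 ?posrE ?exprn_gt0//; nra.
Qed.

(** (k - 1/2)^3 compares with 1/(k-1)^2 - 1/k^2 = 2 (k - 1/2) / (k (k - 1))^2. *)
Lemma inv_freq3_le k : (2 <= k)%N ->
  (freq k ^+ 3)^-1 <= (2 * pi ^+ 3)^-1 * ((k.-1%:R ^+ 2)^-1 - (k%:R ^+ 2)^-1) :> R.
Proof.
case: k => [//|k] k0; rewrite -pred_Sn /freq exprMn invfM [leLHS]mulrC.
rewrite [(2 * _)^-1]invfM [2^-1 * _]mulrC -[leRHS]mulrA.
have p0 := pi_gt0 R; rewrite ler_wpM2l ?invr_ge0 ?exprn_ge0 ?pi_ge0// -natr1.
have : 1 <= k%:R :> R by rewrite ler1n.
move: (k%:R) => q q1.
have -> : 2^-1 * ((q ^+ 2)^-1 - ((q + 1) ^+ 2)^-1) = ((q * (q + 1)) ^+ 2 / (q + 2^-1))^-1 :> R.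
  by field; rewrite !gt_eqF//; lra.
rewrite lef_pV2 ?posrE ?divr_gt0 ?exprn_gt0 ?mulr_gt0//; try lra.
rewrite ler_pdivrMr; last lra.
have -> : q + 1 - 2^-1 = q + 2^-1 by lra.
rewrite -exprSr (exprM _ 2 2) lerXn2r ?nnegrE//; nra.
Qed.

Lemma sum_le_telescope (f U : nat -> R) m M :
  (forall k, (m < k)%N -> f k <= U k.-1 - U k) -> (m <= M)%N ->
  \sum_(m.+1 <= k < M.+1) f k <= U m - U M.
Proof.
move=> H; elim: M => [|M IH]; first by rewrite leqn0 => /eqP ->; rewrite big_geq// subrr.
rewrite leq_eqVlt => /orP[/eqP ->|]; first by rewrite big_geq// subrr.
rewrite ltnS => mM; rewrite big_nat_recr//=.
have := IH mM; have := H M.+1 mM; rewrite /=; lra.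
Qed.

Section Fixed.
Variables (x t : R).
Hypotheses (x0 : 0 <= x) (t0 : 0 <= t).

Let a := x * expR (- (x * t)).

Let a_itv : 0 <= a <= x.
Proof.
rewrite /a mulr_ge0 ?expR_ge0//= ler_piMr// -[leRHS]expR0 ler_expR.
by rewrite oppr_le0 mulr_ge0.
Qed.

Let at_le : a * t <= 2^-1.
Proof.
rewrite /a mulrAC; apply: expRN_le; exact: mulr_ge0.
Qed.

Let cross_le k : 0 < t -> (2 <= k)%N -> 2 * a / freq k ^+ 3 <=
   (2 * t * pi ^+ 3)^-1 * ((k.-1%:R ^+ 2)^-1 - (k%:R ^+ 2)^-1).
Proof.
move=> t1 k2; have l0 := @freq_gt0 k (ltnW k2).
apply: (@le_trans _ _ (t^-1 / freq k ^+ 3)).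
  rewrite ler_wpM2r ?invr_ge0 ?exprn_ge0 ?(ltW l0)//.
  by rewrite -[t^-1]mul1r ler_pdivlMr//; move: at_le; lra.
rewrite -(mulrA 2) (mulrCA 2) [(t * _)^-1]invfM -[leRHS]mulrA ler_wpM2l ?invr_ge0//.
exact: inv_freq3_le.
Qed.

Lemma sphi_sqr_le_sin k : (0 < k)%N -> 0 <= sin (freq k * t) ->
  sphi x k t ^+ 2 <= (freq k ^+ 2)^-1.
Proof.
by move=> k0 s0; apply: phi_sqr_le_sin => //; [exact: freq_gt0|exact: cos2Dsin2].
Qed.

(** The potential is U k = (1/k + 1/(2 pi t k^2)) / pi^2, and pi t >= 1/2 gives
    1/m + 1/m^2 <= 1/(m - 1). *)
Lemma sum_sphi_large m M : 2^-1 <= pi * t -> (2 <= m <= M)%N ->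
  \sum_(m.+1 <= k < M.+1) sphi x k t ^+ 2 <= (pi ^+ 2 * (m%:R - 1))^-1.
Proof.
move=> d /andP[m2 mM].
have p0 := pi_gt0 R; have t1 : 0 < t by rewrite -(pmulr_rgt0 _ p0); lra.
pose U (k : nat) : R := (pi ^+ 2)^-1 * (k%:R)^-1 + (2 * t * pi ^+ 3)^-1 * (k%:R ^+ 2)^-1.
have U0 k : 0 <= U k.
  by rewrite addr_ge0// mulr_ge0// invr_ge0 ?mulr_ge0 ?exprn_ge0// ltW.
apply: (@le_trans _ _ (U m - U M)).
  apply: sum_le_telescope => // k mk.
  have k2 : (2 <= k)%N by rewrite (leq_trans m2)// ltnW.
  have l0 := @freq_gt0 k (ltnW k2).
  apply: (le_trans (phi_sqr_le_cubic l0 a_itv (cos2Dsin2 _))).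
  have := cross_le t1 k2; have := inv_freq2_le k2; rewrite /U; lra.
have : 0 <= U M by [].
suff : U m <= (pi ^+ 2 * (m%:R - 1))^-1 by lra.
have : 2 <= m%:R :> R by rewrite ler_nat.
rewrite /U; move: (m%:R) => q q2.
rewrite (_ : 2 * t * pi ^+ 3 = pi ^+ 2 * (2 * (pi * t))); last by ring.
rewrite !(invfM (pi ^+ 2)) -[X in _ + X]mulrA -mulrDr ler_wpM2l ?invr_ge0 ?exprn_ge0 ?(ltW p0)//.
apply: (@le_trans _ _ (q^-1 + (q ^+ 2)^-1)).
  rewrite lerD2l// ler_piMl ?invr_ge0 ?sqr_ge0//.
  by rewrite invf_le1; lra.
have -> : q^-1 + (q ^+ 2)^-1 = (q + 1) / q ^+ 2 by field; lra.
by rewrite ler_pdivrMr ?exprn_gt0 1?[leRHS]mulrC ?ler_pdivlMr; nra.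
Qed.

Local Notation g := (inv_sqr_re x).
Local Notation h := (inv_sqr_im x).

(** The potential that telescopes the double-angle terms.  As
    2 lambda_k t +- pi t is 2 pi t k or 2 pi t (k - 1), multiplying
    cos (2 lambda_k t) and sin (2 lambda_k t) by 2 sin (pi t) turns them into
    differences; summation by parts then leaves the variation of the amplitude,
    which the increment of the extra summand 1/lambda_k^2 dominates. *)
Let V (k : nat) : R := g (freq k) * sin (2 * pi * t * k%:R) + h (freq k) * cos (2 * pi * t * k%:R)
   + (freq k ^+ 2)^-1.

Let V_itv k : (0 < k)%N -> 0 <= V k <= 2 * (freq k ^+ 2)^-1.
Proof.
move=> k0; have l0 := @freq_gt0 k k0; have H := osc_norm x l0.
have v0 : 0 <= (freq k ^+ 2)^-1 :> R by rewrite invr_ge0 sqr_ge0.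
have sc u : sin u ^+ 2 + cos u ^+ 2 = 1 :> R by rewrite addrC cos2Dsin2.
have := dot_le (sc (2 * pi * t * k%:R)) v0 H.
have H2 := H; rewrite -[X in X + _]sqrrN -[X in _ + X]sqrrN in H2.
have := dot_le (sc (2 * pi * t * k%:R)) v0 H2.
rewrite /V !mulNr; lra.
Qed.

Let osc_telescope k : (2 <= k)%N -> 0 < sin (pi * t) ->
  - (2^-1 * ((freq k ^+ 2 - x ^+ 2) * (cos (freq k * t) ^+ 2 - sin (freq k * t) ^+ 2)
       - 2 * freq k * x * (2 * cos (freq k * t) * sin (freq k * t)))
     / (x ^+ 2 + freq k ^+ 2) ^+ 2) <= (4 * sin (pi * t))^-1 * (V k.-1 - V k).
Proof.
case: k => [//|k] k1; rewrite -pred_Sn => d0.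
have l0 : 0 < freq k :> R by exact: freq_gt0.
have lS : freq k <= freq k.+1 :> R by rewrite freqS lerDl pi_ge0.
have H := osc_diff x l0 lS.
rewrite (_ : - _ = - 2^-1 * (g (freq k.+1) * (cos (freq k.+1 * t) ^+ 2 - sin (freq k.+1 * t) ^+ 2)
  - h (freq k.+1) * (2 * cos (freq k.+1 * t) * sin (freq k.+1 * t)))); last first.
  by rewrite /inv_sqr_re /inv_sqr_im; field; rewrite gt_eqF ?resolvent_gt0// freq_gt0.
rewrite [leRHS]mulrC ler_pdivlMr ?mulr_gt0//.
pose u : R := 2 * pi * t * k%:R.
have Eu : 2 * pi * t * k.+1%:R = u + 2 * (pi * t) by rewrite /u -natr1; ring.
have Ef : freq k.+1 * t *+ 2 = u + pi * t.
  by rewrite /freq /u -natr1 -mulr_natr; field.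
have c2 : cos (freq k.+1 * t) ^+ 2 - sin (freq k.+1 * t) ^+ 2 = cos (u + pi * t).
  by rewrite -Ef cos_mulr2n sin2cos2; ring.
have s2 : 2 * cos (freq k.+1 * t) * sin (freq k.+1 * t) = sin (u + pi * t).
  by rewrite -Ef sin_mulr2n; ring.
rewrite c2 s2 /V Eu -/u.
move: H; set G' := g (freq k.+1); set G := g (freq k).
set K' := h (freq k.+1); set K := h (freq k) => H.
have E1 : u + 2 * (pi * t) = (u + pi * t) + pi * t by ring.
have E2 : u = (u + pi * t) - pi * t by ring.
have C2 : 2 * sin (pi * t) * cos (u + pi * t) = sin (u + 2 * (pi * t)) - sin u.
  by rewrite E1 [sin u](congr1 sin E2) (sinB (u + _)) (sinD (u + _)); ring.
have S2 : 2 * sin (pi * t) * sin (u + pi * t) = cos u - cos (u + 2 * (pi * t)).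
  by rewrite E1 [cos u](congr1 cos E2) (cosB (u + _)) (cosD (u + _)); ring.
have v0 : 0 <= (freq k ^+ 2)^-1 - (freq k.+1 ^+ 2)^-1 :> R.
  by rewrite subr_ge0 lef_pV2 ?posrE ?exprn_gt0// ?lerXn2r ?nnegrE//; lra.
have sc : sin u ^+ 2 + cos u ^+ 2 = 1 :> R by rewrite addrC cos2Dsin2.
have := dot_le sc v0 H.
have -> : - 2^-1 * (G' * cos (u + pi * t) - K' * sin (u + pi * t)) * (4 * sin (pi * t)) =
  - (G' * (2 * sin (pi * t) * cos (u + pi * t)) - K' * (2 * sin (pi * t) * sin (u + pi * t))) by field.
rewrite C2 S2; nra.
Qed.

Let U (k : nat) : R := 9 / 16 * (pi ^+ 2)^-1 * (k%:R)^-1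
   + (2 * t * pi ^+ 3)^-1 * (k%:R ^+ 2)^-1 + (4 * sin (pi * t))^-1 * V k.

(** Clearing denominators and setting q = p + 2 leaves a polynomial in p with
    nonnegative coefficients. *)
Let small_poly (q : R) : 2 <= q ->
  9 / 16 / q + 10 / 56 * (q + 2^-1) / q ^+ 2 + 10 / 49 * (q + 2^-1) / (q - 2^-1) ^+ 2 <= (q - 1)^-1.
Proof.
move=> q2; rewrite -subr_ge0.
pose p := q - 2; have p0 : 0 <= p by rewrite /p; lra.
have -> : q = p + 2 by rewrite /p; ring.
have p2 : 0 <= p ^+ 2 by exact: sqr_ge0.
have p3 : 0 <= p ^+ 3 by exact: exprn_ge0.
have p4 : 0 <= p ^+ 4 by exact: exprn_ge0.
rewrite [leRHS](_ : _ = ((p + 2) ^+ 2 * (p + 2 - 2^-1) ^+ 2 - (p + 2 - 1) *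
   (9 / 16 * (p + 2) * (p + 2 - 2^-1) ^+ 2 + 10 / 56 * (p + 2 + 2^-1) * (p + 2 - 2^-1) ^+ 2
    + 10 / 49 * (p + 2 + 2^-1) * (p + 2) ^+ 2)) /
    ((p + 2) ^+ 2 * (p + 2 - 2^-1) ^+ 2 * (p + 2 - 1))); last first.
  by field; rewrite !gt_eqF//; lra.
rewrite divr_ge0//; last by rewrite !mulr_ge0 ?sqr_ge0//; lra.
by nra.
Qed.

(** Once lambda_(k+1) t > pi, the boundary terms are controlled by
    1/(pi t) < (k + 1/2)/pi; together with sin (pi t) >= (7/8) pi t and pi >= 14/5
    they fit into the room that 9/16 < 1 leaves. *)
Let U_le k : (2 <= k)%N -> pi * t < 2^-1 -> pi < freq k.+1 * t ->
  U k <= (pi ^+ 2)^-1 * (k%:R - 1)^-1.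
Proof.
move=> k2 d1 d2; have p0 := pi_gt0 R; have p28 := @pi_ge28 R.
have q2 : 2 <= k%:R :> R by rewrite ler_nat.
have d0 : 0 < pi * t.
  have : 0 < freq k.+1 * t by lra.
  by rewrite pmulr_rgt0 ?freq_gt0// => t1; rewrite mulr_gt0.
have sd : 7 / 8 * (pi * t) <= sin (pi * t) by apply: sin_ge_id; lra.
have s0 : 0 < sin (pi * t) by lra.
have dV : (pi * t)^-1 <= (k%:R + 2^-1) * (10 / 28).
  rewrite -div1r ler_pdivrMr//; move: d2; rewrite /freq -natr1; nra.
apply: le_trans (_ : (pi ^+ 2)^-1 * (9 / 16 / k%:R + 10 / 56 * (k%:R + 2^-1) / k%:R ^+ 2 +
   10 / 49 * (k%:R + 2^-1) / (k%:R - 2^-1) ^+ 2) <= _); last first.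
  by rewrite ler_wpM2l ?invr_ge0 ?sqr_ge0// small_poly.
rewrite !mulrDr; apply: lerD; first apply: lerD.
- by rewrite le_eqVlt; apply/orP; left; apply/eqP; field; rewrite !gt_eqF//; lra.
- rewrite (_ : 2 * t * pi ^+ 3 = pi ^+ 2 * (2 * (pi * t))); last by ring.
  rewrite (invfM (pi ^+ 2)) -[leLHS]mulrA ler_wpM2l ?invr_ge0 ?sqr_ge0// ler_wpM2r ?invr_ge0 ?sqr_ge0//.
  by rewrite (invfM 2); lra.
- have /andP[_ V2] := V_itv (ltnW k2).
  apply: (@le_trans _ _ ((4 * (7 / 8 * (pi * t)))^-1 * (2 * (freq k ^+ 2)^-1))).
    apply: ler_pM => //; rewrite ?invr_ge0; first lra.
      by have /andP[] := V_itv (ltnW k2).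
    by rewrite lef_pV2 ?posrE; lra.
  rewrite /freq exprMn [(_ ^+ 2 * pi ^+ 2)^-1]invfM.
  rewrite [leLHS](_ : _ = (pi ^+ 2)^-1 * ((4 / 7 * (pi * t)^-1) * ((k%:R - 2^-1) ^+ 2)^-1)); last first.
    by field; rewrite !gt_eqF//; try lra; move: d0; rewrite pmulr_rgt0.
  rewrite ler_wpM2l ?invr_ge0 ?sqr_ge0// ler_wpM2r ?invr_ge0 ?sqr_ge0//; lra.
Qed.

(** A single potential Q covers both regimes: it is G while the next angle is
    still at most pi, where [phi_sqr_le_sin] applies, and U afterwards.  The switch
    from G to U is harmless because U <= G there. *)
Lemma sum_sphi_small m M : pi * t < 2^-1 -> (2 <= m <= M)%N ->
  \sum_(m.+1 <= k < M.+1) sphi x k t ^+ 2 <= (pi ^+ 2 * (m%:R - 1))^-1.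
Proof.
move=> d /andP[m2 mM]; have p0 := pi_gt0 R.
pose G (k : nat) : R := (pi ^+ 2)^-1 * (k%:R - 1)^-1.
pose Q (k : nat) : R := if freq k.+1 * t <= pi then G k else U k.
have G0 k : (2 <= k)%N -> 0 <= G k.
  by move=> k2; rewrite mulr_ge0 ?invr_ge0 ?sqr_ge0// subr_ge0 ler1n ltnW.
have QG k : (2 <= k)%N -> Q k <= G k.
  by move=> k2; rewrite /Q; case: ifPn => [//|]; rewrite -ltNge => h'; exact: (U_le k2 d h').
have tS k : freq k * t <= freq k.+1 * t by rewrite freqS mulrDl lerDl mulr_ge0// ltW.
have sin0' : 0 < t -> 0 < sin (pi * t).
  move=> t1; have d0 : 0 < pi * t by rewrite mulr_gt0.
  by have : 7 / 8 * (pi * t) <= sin (pi * t); [apply: sin_ge_id; lra|lra].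
have Q0 k : (2 <= k)%N -> 0 <= Q k.
  move=> k2; rewrite /Q; case: ifPn => [_|]; first exact: G0.
  rewrite -ltNge => h'.
  have t1 : 0 < t.
    by have : 0 < freq k.+1 * t; [lra|rewrite pmulr_rgt0 ?freq_gt0].
  have /andP[V0 _] := V_itv (ltnW k2).
  have s0 := sin0' t1.
  rewrite /U; apply: addr_ge0; first apply: addr_ge0.
  - by apply: mulr_ge0; rewrite ?invr_ge0// mulr_ge0 ?invr_ge0 ?sqr_ge0//.
  - apply: mulr_ge0; rewrite invr_ge0 ?sqr_ge0//.
    by apply: mulr_ge0; [lra|rewrite exprn_ge0// ltW].
  - by apply: mulr_ge0 => //; rewrite invr_ge0; lra.
apply: (@le_trans _ _ (Q m - Q M)); last first.
  have := QG _ m2; have := Q0 _ (leq_trans m2 mM); rewrite /G invfM; lra.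
apply: sum_le_telescope => // k mk.
have k2 : (2 < k)%N by rewrite (leq_trans _ mk).
have l0 := @freq_gt0 k (ltn_trans (isT : (0 < 2)%N) k2).
have kE : k = k.-1.+1 by rewrite prednK// (leq_trans _ k2).
have [h'|h'] := leP (freq k * t) pi; last first.
  have t1 : 0 < t by have : 0 < freq k * t; [lra|rewrite pmulr_rgt0].
  rewrite /Q -kE ifF; last by apply/negbTE; rewrite -ltNge.
  rewrite ifF; last by apply/negbTE; rewrite -ltNge (lt_le_trans h').
  apply: (le_trans (phi_sqr_le_osc l0 a_itv (cos2Dsin2 _))).
  have := cross_le t1 (ltnW k2); have := inv_freq2_le (ltnW k2).
  have := osc_telescope (ltnW k2) (sin0' t1).
  rewrite /U; move: (V k) (V k.-1) => V1 V2; lra.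
have : Q k <= G k by apply: QG; exact: ltnW.
rewrite {2}/Q -kE h'.
suff : sphi x k t ^+ 2 <= G k.-1 - G k by lra.
apply: (@le_trans _ _ (freq k ^+ 2)^-1).
  apply: sphi_sqr_le_sin; first by rewrite kE.
  by apply: sin_ge0_pi; rewrite h' mulr_ge0// ltW.
apply: (le_trans (inv_freq2_le (ltnW k2))).
rewrite /G -mulrBr ler_wpM2l ?invr_ge0 ?sqr_ge0//.
rewrite kE /= -natr1 addrK.
have : 2 <= k.-1%:R :> R by rewrite ler_nat -ltnS -kE.
move: (k.-1%:R) => q q2.
rewrite -subr_ge0 (_ : _ - _ = 2 / (q * (q ^+ 2 - 1))); last first.
  by field; rewrite !gt_eqF//; nra.
by rewrite divr_ge0// mulr_ge0//; nra.
Qed.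

Lemma sum_sphi_le m M : (2 <= m)%N ->
  \sum_(m.+1 <= k < M) sphi x k t ^+ 2 <= (pi ^+ 2 * (m%:R - 1))^-1.
Proof.
move=> m2; have p0 := pi_gt0 R.
have [mM|Mm] := leqP m.+1 M; last first.
  rewrite big_geq ?(ltnW Mm)// invr_ge0 mulr_ge0 ?sqr_ge0// subr_ge0 ler1n.
  exact: ltnW.
case: M mM => // M mM; have [d|d] := leP 2^-1 (pi * t).
  by apply: sum_sphi_large; rewrite ?m2.
by apply: sum_sphi_small; rewrite ?m2.
Qed.

End Fixed.
End ScalarBound.

(** * Negative semidefinite matrices are diagonalizable by a real tight frame *)

Section Spectral.
Local Open Scope sesquilinear_scope.
Context {R : realType} {n : nat}.
Implicit Types L B : 'M[R]_n.
Local Notation C := R[i].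

Lemma conjCE (z : C) : z^*%R = conjc z.
Proof. by []. Qed.

Lemma sum_two (V : nmodType) (F : 'I_n -> V) i j : i != j ->
  (forall k, k != i -> k != j -> F k = 0) -> \sum_k F k = F i + F j.
Proof.
move=> ij H; rewrite (bigD1 i)//= (bigD1 j) 1?eq_sym//= big1 ?addr0// => k /andP[ki kj].
exact: H.
Qed.

(** Evaluate the form at (3/5) e_i + (4/5) sqrt(-1) e_j, a unit vector: the
    imaginary part is a nonzero multiple of L i j - L j i and must vanish. *)
Lemma nsd_sym L : negative_semidefinite L -> L^T = L.
Proof.
move=> nsd; apply/matrixP => i j; rewrite mxE.
have [->//|ij] := eqVneq i j.
have [x [xi xj x0]] : exists x : 'cV[C]_n, [/\ x i 0 = Complex (3/5) 0,
    x j 0 = Complex 0 (4/5) & forall k, k != i -> k != j -> x k 0 = 0].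
  exists (\col_k (if k == i then Complex (3/5) 0
                  else if k == j then Complex 0 (4/5) else 0)).
  split=> [||k ki kj]; rewrite mxE ?eqxx//; first by rewrite eq_sym (negbTE ij).
  by rewrite (negbTE ki) (negbTE kj).
have nx : \sum_k `|x k 0| ^+ 2 = 1.
  rewrite (sum_two ij); last by move=> k ki kj; rewrite x0// normr0 expr0n.
  rewrite xi xj -!add_Re2_Im2/=; rewrite -rmorphD/=; apply/eqP; rewrite eq_complex/= eqxx andbT; apply/eqP; lra.
have [r _] := nsd _ (ex_intro2 _ _ x nx erefl).
rewrite mxE (sum_two ij); last by move=> k ki kj; rewrite x0// mulr0.
rewrite xi xj !mxE !(sum_two ij); try by move=> k ki kj; rewrite !mxE x0// conjc0 mul0r.
rewrite !mxE xi xj => /eqP; rewrite eq_complex/= => /andP[_ /eqP]; lra.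
Qed.

(** The complex spectral theorem gives a unitary P with P L = D P.  Stacking the
    real and imaginary parts of P produces a real matrix with 2n rows that still
    satisfies Q^T Q = 1 and intertwines L with a diagonal.  Its rows are not
    orthonormal, but being an isometry is enough for Frobenius norms.  Each
    eigenvalue is the value of the quadratic form at a conjugated row of P, hence
    nonpositive. *)
Lemma real_spectral L : negative_semidefinite L ->
  exists p (Q : 'M[R]_(p, n)) (d : 'I_p -> R),
  [/\ Q^T *m Q = 1%:M, forall a i, \sum_j Q a j * L j i = d a * Q a i & forall a, d a <= 0].
Proof.
move=> nsd; have Lsym := nsd_sym nsd.
pose A : 'M[C]_n := map_mx (real_complex R) L.
have AE i j : A i j = Complex (L i j) 0 by rewrite mxE.
have Anormal : A \is normalmx.
  apply/normalmxP; suff -> : A^t* = A by [].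
  by apply/matrixP => i j; rewrite !mxE -[in LHS]Lsym mxE conjCE conjc_real.
have /orthomx_spectralP := Anormal.
set P := spectralmx A; set sp := spectral_diag A => EA.
have Pu : P \is unitarymx by exact: spectral_unitarymx.
have PP : P *m P^t* = 1%:M by apply/unitarymxP.
have PP' : P^t* *m P = 1%:M by rewrite -invmx_unitary// mulVmx// unitarymx_unit.
have PA : P *m A = diag_mx sp *m P.
  by rewrite [in LHS]EA !mulmxA mulmxV ?mul1mx// unitarymx_unit.
have spE a : exists2 r : R, r <= 0 & sp 0 a = Complex r 0.
  pose x : 'cV[C]_n := (row a P)^t*.
  have nx : \sum_k `|x k 0| ^+ 2 = 1.
    have := congr1 (fun M : 'M[C]_n => M a a) PP; rewrite !mxE eqxx => H1; apply: etrans H1.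
    by apply: eq_bigr => k _; rewrite !mxE sqr_normc conjCE conjcK mulrC.
  have [r r0 H] := nsd _ (ex_intro2 _ _ x nx erefl).
  exists r => //; rewrite -[RHS]/(real_complex R r) H.
  have <- : (P *m A *m P^t* ) a a = sp 0 a.
    by rewrite PA -mulmxA PP mulmx1 mxE eqxx.
  rewrite !mxE; apply: eq_bigr => k _; rewrite !mxE; congr (_ * _).
  by apply: eq_bigr => l _; rewrite !mxE conjCE conjcK.
pose Q := col_mx (map_mx (@complex.Re R) P) (map_mx (@complex.Im R) P).
pose d0 (a : 'I_n) : R := complex.Re (sp 0 a).
pose d (a : 'I_(n + n)) : R := match fintype.split a with inl b => d0 b | inr b => d0 b end.
have spd a : sp 0 a = Complex (d0 a) 0 by rewrite /d0; have [r _ ->] := spE a.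
exists (n + n)%N, Q, d; split.
- apply/matrixP => i j; rewrite /Q tr_col_mx mul_row_col !mxE.
  have /(congr1 (fun M : 'M[C]_n => complex.Re (M i j))) := PP'.
  rewrite !mxE [RHS](_ : _ = (i == j)%:R); last by case: (i == j).
  move=> <-; rewrite -big_split/= raddf_sum; apply: eq_bigr => k _.
  by rewrite !mxE conjCE; case: (P k i) => u v; case: (P k j) => u' v'/=; ring.
- move=> a i.
  have H b : \sum_j P b j * A j i = sp 0 b * P b i.
    have := congr1 (fun M : 'M[C]_n => M b i) PA.
    by rewrite mul_diag_mx !mxE; apply: etrans; apply: eq_bigr => k _; rewrite !mxE.
  rewrite /Q /d; case: (split_ordP a) => b ->; rewrite ?(unsplitK (inl b)) ?(unsplitK (inr b)).
    have := congr1 (@complex.Re R) (H b).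
    rewrite raddf_sum spd col_mxEu mxE => e; apply: etrans; first apply: etrans e.
      by apply: eq_bigr => k _; rewrite col_mxEu !mxE; case: (P b k) => u v /=; ring.
    by case: (P b i) => u v /=; ring.
  have := congr1 (@complex.Im R) (H b).
  rewrite raddf_sum spd col_mxEd mxE => e; apply: etrans; first apply: etrans e.
    by apply: eq_bigr => k _; rewrite col_mxEd !mxE; case: (P b k) => u v /=; ring.
  by case: (P b i) => u v /=; ring.
- by move=> a; rewrite /d; case: fintype.split => b; rewrite /d0; have [r r0 ->] := spE b.
Qed.
End Spectral.

(** * The matrix exponential and the cosine matrix function in spectral coordinates *)

Section Cvg.
Context {R : realType}.

Lemma cvg_sumr (T : Type) (F : set_system T) {FF : Filter F} (I : Type) (r : seq I)
    (f : I -> T -> R) (l : I -> R) : (forall i, f i x @[x --> F] --> l i) ->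
  \sum_(i <- r) f i x @[x --> F] --> \sum_(i <- r) l i.
Proof.
move=> H; elim: r => [|i r IH].
  rewrite big_nil (_ : (fun x => _) = fun=> 0); last by apply/funext => x; rewrite big_nil.
  exact: cvg_cst.
rewrite big_cons (_ : (fun x => _) = (f i \+ fun x => \sum_(j <- r) f j x)); last first.
  by apply/funext => x; rewrite big_cons.
exact: cvgD.
Qed.

Lemma cvg_mx_entry m n (u : nat -> 'M[R]_(m, n)) (M : 'M[R]_(m, n)) :
  (forall i j, u k i j @[k --> \oo] --> M i j) -> u @ \oo --> M.
Proof.
move=> H A [P HP sPA]; rewrite /nbhs/=.
have : \forall k \near \oo, forall ij : 'I_m * 'I_n, P ij.1 ij.2 (u k ij.1 ij.2).
  by apply: filter_forall => -[i j]; exact: (H i j _ (HP i j)).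
by apply: filterS => k Pk; apply: sPA => i j; exact: (Pk (i, j)).
Qed.

Lemma lim_mx_entry m n (u : nat -> 'M[R]_(m, n)) (M : 'M[R]_(m, n)) :
  (forall i j, u k i j @[k --> \oo] --> M i j) -> limn u = M.
Proof.
move=> H; have uM := cvg_mx_entry H.
have uL : u @ \oo --> limn u by apply/cvg_ex; exists M.
apply/matrixP => i j.
have := cvg_comp _ _ uL (@coord_continuous R m n i j (limn u)) => h.
exact: (cvg_unique _ h (H i j)).
Qed.

Section Expm.
Variables (n p : nat) (L : 'M[R]_n) (Q : 'M[R]_(p, n)) (d : 'I_p -> R).
Hypotheses (QQ : Q^T *m Q = 1%:M) (QL : forall a i, \sum_j Q a j * L j i = d a * Q a i).

Lemma expr_spectral s k i j :
  ((s *: L) ^+ k) i j = \sum_a (s * d a) ^+ k * (Q a i * Q a j).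
Proof.
elim: k j => [|k IH] j.
  rewrite expr0; have := congr1 (fun M : 'M[R]_n => M i j) QQ; rewrite mxE => e.
  rewrite -[LHS]e; apply: eq_bigr => a _; by rewrite !mxE expr0 mul1r.
rewrite exprSr mxE; under eq_bigr do rewrite IH mulr_suml.
rewrite exchange_big/=; apply: eq_bigr => a _.
transitivity (s * (s * d a) ^+ k * Q a i * (\sum_l Q a l * L l j)).
  by rewrite mulr_sumr; apply: eq_bigr => l _; rewrite mxE; ring.
by rewrite QL exprSr; ring.
Qed.

(** Since entries of (sL)^k are combinations of the powers (s d_a)^k, the
    exponential series converges entrywise to the scalar exponentials. *)
Lemma expm_spectral s i j :
  expm (s *: L) i j = \sum_a expR (s * d a) * (Q a i * Q a j).
Proof.
pose M : 'M[R]_n := \matrix_(i, j) \sum_a expR (s * d a) * (Q a i * Q a j).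
suff -> : expm (s *: L) = M by rewrite mxE.
apply: lim_mx_entry => {}i {}j; rewrite mxE.
rewrite (_ : (fun k => _) = (fun k => \sum_a (series (exp_coeff (s * d a)) k * (Q a i * Q a j)))); last first.
  apply/funext => k; rewrite /series/= summxE.
  transitivity (\sum_(0 <= l < k) (l`!%:R)^-1 * ((s *: L) ^+ l) i j).
    by apply: eq_bigr => l _; rewrite [LHS]mxE.
  under [LHS]eq_bigr do rewrite expr_spectral mulr_sumr.
  rewrite exchange_big/=; apply: eq_bigr => a _; rewrite mulr_suml.
  by apply: eq_bigr => l _; rewrite /exp_coeff/=; ring.
apply: (@cvg_sumr nat \oo _ _ _ (fun a k => series (exp_coeff (s * d a)) k * (Q a i * Q a j))) => a.
apply: cvgM; last exact: cvg_cst.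
exact: is_cvg_series_exp_coeff.
Qed.

End Expm.

Lemma continuous_exp_cos (t z l : R) : continuous (fun s : R => expR ((t - s) * z) * cos (l * s)).
Proof.
move=> s; apply: cvgM.
  apply: (@continuous_comp _ _ _ (fun s => (t - s) * z) expR); last exact: continuous_expR.
  by apply: cvgM; [apply: cvgB; [exact: cvg_cst|exact: cvg_id]|exact: cvg_cst].
apply: (@continuous_comp _ _ _ (fun s => l * s) cos); last exact: continuous_cos.
by apply: cvgM; [exact: cvg_cst|exact: cvg_id].
Qed.

Lemma integrable_cont (f : R -> R) (a b : R) : continuous f ->
  lebesgue_measure.-integrable `[a, b] (EFin \o f).
Proof.
move=> cf; apply: continuous_compact_integrable; first exact: segment_compact.
exact: continuous_subspaceT.
Qed.

Lemma integral_FTC (f F : R -> R) (a b : R) : a <= b -> continuous f ->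
  (forall x : R, is_derive x (1 : R) F (f x)) ->
  (\int[lebesgue_measure]_(x in `[a, b]) (f x)%:E = (F b - F a)%:E)%E.
Proof.
rewrite le_eqVlt => /orP[/eqP <-|ab] cf dF.
  by rewrite set_itv1 integral_set1 subrr.
have cF : continuous F by move=> x; apply: differentiable_continuous; apply/derivable1_diffP; have [] := dF x.
rewrite (@continuous_FTC2 _ f F) ?EFinB//; first exact: continuous_subspaceT.
  split; first by move=> x _; have [] := dF x.
    by apply: cvg_at_right_filter; exact: cF.
  by apply: cvg_at_left_filter; exact: cF.
by move=> x _; rewrite derive1E; have [_ ->] := dF x.
Qed.

(** The antiderivative of e^((t-s)z) cos(l s) is
    e^((t-s)z) (l sin(l s) - z cos(l s)) / (z^2 + l^2). *)
Lemma Rintegral_exp_cos (k : nat) (t z : R) : (0 < k)%N -> 0 <= t ->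
  \int[lebesgue_measure]_(s in `[0, t]) (expR ((t - s) * z) * cos (freq k * s))
  = sphi (- z) k t.
Proof.
move=> k0 t0; have l0 := @freq_gt0 R k k0; set l := freq k in l0 *.
pose F s : R := (z ^+ 2 + l ^+ 2)^-1 * (expR ((t - s) * z) * (l * sin (l * s) - z * cos (l * s))).
have r0 : z ^+ 2 + l ^+ 2 != 0 by rewrite gt_eqF ?resolvent_gt0.
have dF (x : R) : is_derive x (1 : R) F (expR ((t - x) * z) * cos (l * x)).
  have d1 : is_derive x (1 : R) (fun s : R => (t - s) * z) (- z).
    by apply: is_derive_eq; rewrite /GRing.scale/=; ring.
  have d2 : is_derive x (1 : R) (fun s : R => l * s) l.
    by apply: is_derive_eq; rewrite /GRing.scale/=; ring.
  have d3 := @is_derive1_comp _ expR _ _ _ _ (is_derive_expR _) d1.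
  have d4 := @is_derive1_comp _ sin _ _ _ _ (is_derive_sin _) d2.
  have d5 := @is_derive1_comp _ cos _ _ _ _ (is_derive_cos _) d2.
  apply: is_derive_eq; rewrite /GRing.scale/=.
  by field.
rewrite /Rintegral (@integral_FTC _ F _ _ t0 (@continuous_exp_cos t z l) dF)/=.
rewrite /F subr0 subrr mul0r expR0 mulr0 sin0 cos0 /sphi -/l !mulNr opprK sqrrN [z * t]mulrC.
by rewrite opprK; field.
Qed.

Lemma integrable_sumr (e : measure_display) (T : measurableType e)
    (mu : {measure set T -> \bar R}) (D : set T) (I : Type) (r : seq I)
    (f : I -> T -> R) : measurable D ->
  (forall i, mu.-integrable D (EFin \o f i)) ->
  mu.-integrable D (EFin \o (fun x => \sum_(i <- r) f i x)).
Proof.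
move=> mD H; rewrite (_ : _ \o _ = fun x => (\sum_(i <- r) (f i x)%:E)%E).
  by apply: integrable_sum => // i _; exact: H.
by apply/funext => x; rewrite /= sumEFin.
Qed.

Lemma Rintegral_sumr (e : measure_display) (T : measurableType e)
    (mu : {measure set T -> \bar R}) (D : set T) (I : Type) (r : seq I)
    (f : I -> T -> R) : measurable D ->
  (forall i, mu.-integrable D (EFin \o f i)) ->
  \int[mu]_(x in D) (\sum_(i <- r) f i x) = \sum_(i <- r) \int[mu]_(x in D) f i x.
Proof.
move=> mD H; elim: r => [|i r IH].
  rewrite big_nil; under eq_Rintegral do rewrite big_nil.
  by rewrite /Rintegral integral0.
rewrite big_cons -IH -(RintegralD mD (H i) (integrable_sumr r mD H)).
by apply: eq_Rintegral => x _; rewrite big_cons.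
Qed.

Section PhiCos.
Variables (n p : nat) (L B : 'M[R]_n) (Q : 'M[R]_(p, n)) (d : 'I_p -> R).
Hypotheses (QQ : Q^T *m Q = 1%:M) (QL : forall a i, \sum_j Q a j * L j i = d a * Q a i).
Variables (k : nat) (t : R).
Hypotheses (k0 : (0 < k)%N) (t0 : 0 <= t).

Lemma phi_cos_spectral i j :
  phi_cos k t L i j = \sum_a sphi (- d a) k t * (Q a i * Q a j).
Proof.
rewrite mxE; under eq_Rintegral do rewrite (expm_spectral QQ QL) mulr_suml.
rewrite Rintegral_sumr//; last first.
  move=> a; apply: integrable_cont => x; rewrite (_ : (fun s => _) = fun s => (Q a i * Q a j) * (expR ((t - s) * d a) * cos (freq k * s))).
    by apply: cvgM; [exact: cvg_cst|exact: continuous_exp_cos].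
  by apply/funext => s; ring.
apply: eq_bigr => a _; rewrite -(Rintegral_exp_cos _ k0 t0) -RintegralZr//.
  by apply: eq_Rintegral => s _; ring.
by apply: integrable_cont; exact: continuous_exp_cos.
Qed.

Lemma frobenius_tight (M : 'M[R]_n) :
  frobenius_norm M ^+ 2 = \sum_a \sum_j ((Q *m M) a j) ^+ 2.
Proof.
have s0 : 0 <= \sum_(i < n) \sum_(j < n) M i j ^+ 2.
  by apply: sumr_ge0 => i _; apply: sumr_ge0 => j _; exact: sqr_ge0.
rewrite /frobenius_norm sqr_sqrtr// exchange_big [RHS]exchange_big/=.
apply: eq_bigr => j _.
have E (q : nat) (N : 'M[R]_(q, n)) : \sum_i N i j ^+ 2 = (N^T *m N) j j.
  by rewrite mxE; apply: eq_bigr => i _; rewrite mxE expr2.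
by rewrite !E trmx_mul -mulmxA (mulmxA Q^T) QQ mul1mx.
Qed.

Hypothesis Lsym : L^T = L.

(** Q Q^T need not be the identity, but by symmetry of L it commutes with the
    diagonal matrix of the d_a, so it only mixes rows with equal eigenvalues. *)
Let QQT_comm a b : (Q *m Q^T) a b * d b = d a * (Q *m Q^T) a b.
Proof.
have Lij i j : L i j = L j i by rewrite -[in LHS]Lsym mxE.
rewrite mxE mulr_suml mulr_sumr.
transitivity (\sum_i \sum_j Q a i * (Q b j * L j i)).
  by apply: eq_bigr => i _; rewrite -mulr_sumr QL mxE; ring.
rewrite exchange_big/=; apply: eq_bigr => j _.
rewrite mxE mulrA -QL mulr_suml; apply: eq_bigr => i _.
by rewrite (Lij j i); ring.
Qed.

Lemma mul_phi_cos a j : (Q *m phi_cos k t L) a j = sphi (- d a) k t * Q a j.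
Proof.
have -> : Q a j = \sum_b (Q *m Q^T) a b * Q b j.
  have := congr1 (fun M : 'M[R]_(p, n) => M a j) (mulmxA Q Q^T Q).
  by rewrite QQ mulmx1 [in RHS]mxE.
rewrite mxE mulr_sumr; under eq_bigr do rewrite phi_cos_spectral mulr_sumr.
rewrite exchange_big/=; apply: eq_bigr => b _.
transitivity (sphi (- d b) k t * (Q *m Q^T) a b * Q b j).
  rewrite mxE mulr_sumr mulr_suml; apply: eq_bigr => i _; rewrite mxE; ring.
rewrite mulrA; congr (_ * _).
have [->|/eqP h] := eqVneq ((Q *m Q^T) a b) 0; first by rewrite !mulr0.
suff -> : d b = d a by [].
by apply: (mulfI (introN eqP h)); rewrite QQT_comm mulrC.
Qed.

Lemma frobenius_phi_cos :
  frobenius_norm (phi_cos k t L *m B) ^+ 2 =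
  \sum_a sphi (- d a) k t ^+ 2 * \sum_j ((Q *m B) a j) ^+ 2.
Proof.
rewrite frobenius_tight; apply: eq_bigr => a _; rewrite mulr_sumr; apply: eq_bigr => j _.
rewrite mulmxA -exprMn; congr (_ ^+ 2).
have -> : Q *m phi_cos k t L = \matrix_(a, j) (sphi (- d a) k t * Q a j).
  by apply/matrixP => a' j'; rewrite mul_phi_cos mxE.
by rewrite !mxE mulr_sumr; apply: eq_bigr => i _; rewrite mxE mulrA.
Qed.

End PhiCos.
End Cvg.

(** * The tail of the matrix series *)

Section Tail.
Context {R : realType} {n : nat}.
Implicit Types L B : 'M[R]_n.

(** The point is that the supremum is over a bounded set: the entries of a unit
    vector are at most 1, so row sums of absolute values bound the image. *)
Lemma spectral_norm_ge B x : enorm x <= 1 -> enorm (B *m x) <= spectral_norm B.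
Proof.
move=> x1; apply: ub_le_sup; last by exists x.
exists (Num.sqrt (\sum_i (\sum_j `|B i j|) ^+ 2)) => _ [y /= y1 <-].
rewrite /enorm ler_sqrt ?sumr_ge0// => [|i _]; last exact: sqr_ge0.
apply: ler_sum => i _; rewrite -[leLHS]real_normK ?num_real//.
rewrite lerXn2r ?nnegrE ?normr_ge0 ?sumr_ge0//.
rewrite mxE; apply: le_trans (ler_norm_sum _ _ _) _; apply: ler_sum => j _.
rewrite normrM ler_piMr//.
have s0 : 0 <= \sum_(i < n) y i 0 ^+ 2 by apply: sumr_ge0 => ? _; exact: sqr_ge0.
rewrite -(@ler_pXn2r _ 2%N) ?nnegrE// expr1n real_normK ?num_real//.
have : enorm y ^+ 2 <= 1 by rewrite exprn_ile1// sqrtr_ge0.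
rewrite /enorm sqr_sqrtr//; apply: le_trans.
by rewrite (bigD1 j)//= lerDl sumr_ge0// => ? _; exact: sqr_ge0.
Qed.

(** Each of the n columns is the image of a unit vector. *)
Lemma frobenius_le_spectral B : frobenius_norm B ^+ 2 <= n%:R * spectral_norm B ^+ 2.
Proof.
rewrite /frobenius_norm sqr_sqrtr; last first.
  by apply: sumr_ge0 => i _; apply: sumr_ge0 => j _; exact: sqr_ge0.
rewrite exchange_big/= -[n in n%:R]card_ord -sumr_const mulr_suml.
apply: ler_sum => j _; rewrite mul1r.
pose e : 'cV[R]_n := delta_mx j 0.
have e1 : enorm e <= 1.
  rewrite /enorm (bigD1 j)//= big1 => [|i ij]; last by rewrite mxE (negbTE ij) expr0n.
  by rewrite mxE !eqxx expr1n addr0 sqrtr1.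
have := spectral_norm_ge B e1; rewrite -colE {1}/enorm => H.
have s0 : 0 <= \sum_i B i j ^+ 2 by apply: sumr_ge0 => i _; exact: sqr_ge0.
have H' : Num.sqrt (\sum_i B i j ^+ 2) <= spectral_norm B.
  by apply: le_trans H; rewrite le_eqVlt; apply/orP; left; apply/eqP;
     congr Num.sqrt; apply: eq_bigr => i _; rewrite mxE.
rewrite -[leLHS]sqr_sqrtr// lerXn2r ?nnegrE ?sqrtr_ge0//.
by apply: le_trans H'; exact: sqrtr_ge0.
Qed.

(** In spectral coordinates the scalar bound [sum_sphi_le] applies to each
    eigenvalue separately, with weights adding up to |B|_F^2. *)
Lemma sum_frobenius_phi_cos L B t m M : negative_semidefinite L -> 0 <= t -> (2 <= m)%N ->
  \sum_(m.+1 <= k < M) frobenius_norm (phi_cos k t L *m B) ^+ 2 <=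
  (pi ^+ 2 * (m%:R - 1))^-1 * (n%:R * spectral_norm B ^+ 2).
Proof.
move=> nsd t0 m2; have [p [Q [d [QQ QL d0]]]] := real_spectral nsd.
have Lsym := nsd_sym nsd.
apply: (@le_trans _ _ ((pi ^+ 2 * (m%:R - 1))^-1 * frobenius_norm B ^+ 2)); last first.
  rewrite ler_wpM2l ?frobenius_le_spectral// invr_ge0 mulr_ge0 ?sqr_ge0// subr_ge0 ler1n.
  exact: ltnW.
rewrite (frobenius_tight QQ B) mulr_sumr.
rewrite (@eq_big_nat _ _ _ _ _ _ (fun k => \sum_a sphi (- d a) k t ^+ 2 * \sum_j ((Q *m B) a j) ^+ 2)); last first.
  by move=> k /andP[mk _]; rewrite (frobenius_phi_cos B QQ QL)// (leq_trans _ mk).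
rewrite exchange_big/=; apply: ler_sum => a _; rewrite -mulr_suml ler_wpM2r//.
  by apply: sumr_ge0 => j _; exact: sqr_ge0.
by apply: sum_sphi_le => //; rewrite oppr_ge0.
Qed.

Lemma tail_phi_cos_le L B t m : negative_semidefinite L -> 0 <= t -> (2 <= m)%N ->
  (2%R%:E * \sum_(m.+1 <= k <oo) (frobenius_norm (phi_cos k t L *m B) ^+ 2)%R%:E
   <= (2 * spectral_norm B ^+ 2 / pi ^+ 2 * (n%:R / (m%:R - 1)))%R%:E)%E.
Proof.
move=> nsd t0 m2.
rewrite (_ : 2 * _ / _ * _ = 2 * ((pi ^+ 2 * (m%:R - 1))^-1 * (n%:R * spectral_norm B ^+ 2))); last first.
  by rewrite (invfM (pi ^+ 2)); ring.
rewrite EFinM lee_pmul2l//; apply: lime_le.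
  by apply: is_cvg_nneseries => k _ _; rewrite lee_fin sqr_ge0.
by apply: nearW => M; rewrite sumEFin lee_fin; exact: sum_frobenius_phi_cos.
Qed.

End Tail.

(** * Mean and variance of a centred normal law *)

Section Gauss.
Context {R : realType}.
Variables (s : R).
Hypothesis s0 : 0 < s.
Local Notation mu := (@lebesgue_measure R).
Local Notation pdf := (normal_pdf 0 s).
Local Notation N := (normal_prob 0 s).

(** The Radon-Nikodym derivative of the normal law agrees almost everywhere with
    the explicit density, because both have the same integrals over measurable
    sets. *)
Lemma ge0_integral_normal (f : R -> \bar R) : measurable_fun [set: R] f ->
  (forall x, 0 <= f x)%E ->
  (\int[N]_x f x = \int[mu]_x (f x * (pdf x)%:E))%E.
Proof.
move=> mf f0.
have dom := normal_prob_dominates 0 s.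
rewrite -(Radon_Nikodym_SigmaFinite.change_of_variables dom f0 measurableT mf).
have mg := measurable_int _ (Radon_Nikodym_SigmaFinite.f_integrable dom).
have mp : measurable_fun [set: R] (fun x => (pdf x)%:E).
  by apply/measurable_EFinP; exact: measurable_normal_pdf.
apply: ge0_ae_eq_integral => //.
- exact: emeasurable_funM.
- exact: emeasurable_funM.
- by move=> x _; rewrite mule_ge0// Radon_Nikodym_SigmaFinite.f_ge0.
- by move=> x _; rewrite mule_ge0// lee_fin normal_pdf_ge0.
have : ae_eq mu setT (Radon_Nikodym_SigmaFinite.f N mu) (fun x => (pdf x)%:E).
  apply: integral_ae_eq => //; first exact: Radon_Nikodym_SigmaFinite.f_integrable.
  by move=> E _ mE; rewrite -Radon_Nikodym_SigmaFinite.f_integral.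
by apply: filterS => x /= h xT; rewrite h.
Qed.

Let e (x : R) := expR (- x ^+ 2 / (s ^+ 2 *+ 2)).

Let pdfE x : pdf x = normal_peak s * e x.
Proof. by rewrite normal_pdfE ?gt_eqF// /normal_fun subr0. Qed.

Let de (x : R) : is_derive x (1 : R) e (- (x / s ^+ 2) * e x).
Proof.
have d1 : is_derive x (1 : R) (fun y : R => - y ^+ 2 / (s ^+ 2 *+ 2)) (- (x / s ^+ 2)).
  apply: is_derive_eq; rewrite /GRing.scale/=.
  by field; rewrite gt_eqF.
have := @is_derive1_comp _ expR _ _ _ _ (is_derive_expR _) d1.
by rewrite mulrC.
Qed.

Let dp (x : R) : is_derive x (1 : R) pdf (- (x / s ^+ 2) * pdf x).
Proof.
rewrite (_ : normal_pdf 0 s = fun x => normal_peak s * e x); last exact/funext.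
by apply: is_derive_eq; rewrite /GRing.scale/= -/(e x); field; rewrite gt_eqF.
Qed.

Let cp : continuous pdf.
Proof. by apply: continuous_normal_pdf; rewrite gt_eqF. Qed.

Let pdf_even x : pdf (- x) = pdf x.
Proof. by rewrite !pdfE /e sqrrN. Qed.

(** The boundary term of the integration by parts in [int_I_sq] vanishes at
    infinity. *)
Let tail_le (k : nat) : k%:R * pdf k%:R <= normal_peak s * s ^+ 2 * (k%:R)^-1.
Proof.
have [->|k0] := posnP k; first by rewrite mul0r invr0 mulr0.
have q0 : 0 < k%:R :> R by rewrite ltr0n.
have s2 : 0 < s ^+ 2 by rewrite exprn_gt0.
rewrite -[leRHS]mulrA pdfE mulrCA ler_wpM2l ?normal_peak_ge0//.
rewrite ler_pdivlMr// mulrAC.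
have h : 0 <= k%:R ^+ 2 / (s ^+ 2 *+ 2) by rewrite divr_ge0 ?sqr_ge0// mulrn_wge0// ltW.
have := expRN_le h; rewrite -mulNr -/(e _) [leLHS]mulrAC ler_pdivrMr ?pmulrn_lgt0//.
by rewrite expr2; lra.
Qed.

(** Moments are computed on the intervals [-k, k], where antiderivatives are
    explicit, and passed to the limit by monotone convergence. *)
Let I (k : nat) : set R := `[- k%:R, k%:R]%classic.

Let I_nd : nondecreasing_seq I.
Proof.
move=> i j ij; apply/subsetPset; apply: subset_itv; rewrite bnd_simp ?lerN2 ler_nat//.
Qed.

Let I_T : \bigcup_i I i = [set: R].
Proof.
rewrite -subTset => x _; exists (Num.trunc `|x|).+1 => //.
rewrite /I/= in_itv/= -ler_norml; apply: ltW.
by have := truncnS_gt `|x|.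
Qed.

Let cvg_I (f : R -> R) : continuous f -> (forall x, 0 <= f x) ->
  (\int[mu]_(x in I k) (f x)%:E @[k --> \oo] --> \int[mu]_x (f x)%:E)%E.
Proof.
move=> cf f0; have := @ge0_nondecreasing_set_cvg_integral _ (measurableTypeR R) R I (EFin \o f) mu I_nd.
rewrite I_T; apply.
- by move=> i; exact: measurable_itv.
- by move=> i; apply/measurable_EFinP; apply: measurable_funTS; exact: continuous_measurable_fun.
- by move=> i x _; rewrite lee_fin.
Qed.

Let csq : continuous (fun x : R => x ^+ 2 * pdf x).
Proof. by move=> x; apply: cvgM; [exact: exprn_continuous|exact: cp]. Qed.

(** The function -s^2 x pdf(x) has derivative x^2 pdf(x) - s^2 pdf(x). *)
Let int_I_sq k : \int[mu]_(x in I k) (x ^+ 2 * pdf x) =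
  s ^+ 2 * \int[mu]_(x in I k) (pdf x) - 2 * s ^+ 2 * (k%:R * pdf k%:R).
Proof.
pose F x := - s ^+ 2 * (x * pdf x).
have dF (x : R) : is_derive x (1 : R) F (x ^+ 2 * pdf x - s ^+ 2 * pdf x).
  have h := dp x; rewrite /F; apply: is_derive_eq; rewrite /GRing.scale/=.
  by field; rewrite gt_eqF.
have cs : continuous (fun x : R => s ^+ 2 * pdf x).
  by move=> x; apply: cvgM; [exact: cvg_cst|exact: cp].
have cf : continuous (fun x : R => x ^+ 2 * pdf x - s ^+ 2 * pdf x).
  by move=> x; apply: cvgB; [exact: csq|exact: cs].
have kk : - k%:R <= k%:R :> R by rewrite ge0_cp ?ler0n.
have := @integral_FTC _ _ F _ _ kk cf dF.
move/(congr1 fine); rewrite -/(Rintegral _ _ _) RintegralB//; last 2 first.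
  exact: integrable_cont.
  exact: integrable_cont.
rewrite RintegralZl//; last by apply: integrable_cont; exact: cp.
by rewrite /F pdf_even/= -/(I k) => /eqP; rewrite subr_eq => /eqP ->; ring.
Qed.

Let int_I_id k : \int[mu]_(x in I k) (x * pdf x) = 0.
Proof.
pose F x := - s ^+ 2 * pdf x.
have dF (x : R) : is_derive x (1 : R) F (x * pdf x).
  have h := dp x; rewrite /F; apply: is_derive_eq; rewrite /GRing.scale/=.
  by field; rewrite gt_eqF.
have cf : continuous (fun x : R => x * pdf x).
  by move=> x; apply: cvgM; [exact: cvg_id|exact: cp].
have kk : - k%:R <= k%:R :> R by rewrite ge0_cp ?ler0n.
have := @integral_FTC _ _ F _ _ kk cf dF.
by move/(congr1 fine); rewrite -/(Rintegral _ _ _) /F pdf_even/= subrr.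
Qed.

Lemma normal_second_moment : (\int[N]_x (x ^+ 2)%:E = (s ^+ 2)%:E)%E.
Proof.
rewrite ge0_integral_normal; last 2 first.
- by apply/measurable_EFinP; exact: exprn_measurable.
- by move=> x; rewrite lee_fin sqr_ge0.
under eq_integral do rewrite -EFinM.
have h1 : (\int[mu]_(x in I k) (x ^+ 2 * pdf x)%:E @[k --> \oo] --> \int[mu]_x (x ^+ 2 * pdf x)%:E)%E.
  by apply: cvg_I => // x; rewrite mulr_ge0 ?sqr_ge0// normal_pdf_ge0.
have h2 : (\int[mu]_(x in I k) (pdf x)%:E @[k --> \oo] --> 1%:E)%E.
  by rewrite -(integral_normal_pdf 0 s); apply: cvg_I => // x; exact: normal_pdf_ge0.
have h3 : \int[mu]_(x in I k) (pdf x) @[k --> \oo] --> (1 : R).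
  by apply: fine_cvg.
have h4 : k%:R * pdf k%:R @[k --> \oo] --> (0 : R).
  apply: (@squeeze_cvgr _ _ _ _ (fun=> 0) (fun k => normal_peak s * s ^+ 2 * (k%:R)^-1)).
  - apply: nearW => k; rewrite tail_le andbT mulr_ge0 ?ler0n//; exact: normal_pdf_ge0.
  - exact: cvg_cst.
  - rewrite -(mulr0 (normal_peak s * s ^+ 2)); apply: cvgM; first exact: cvg_cst.
    by rewrite -cvg_shiftS; exact: cvg_harmonic.
have EI k : (\int[mu]_(x in I k) (x ^+ 2 * pdf x)%:E =
   (\int[mu]_(x in I k) (x ^+ 2 * pdf x))%:E)%E.
  rewrite /Rintegral fineK//; apply: integrable_fin_num; first exact: measurable_itv.
  exact: integrable_cont.
suff h5 : (\int[mu]_(x in I k) (x ^+ 2 * pdf x)%:E @[k --> \oo] --> (s ^+ 2)%:E)%E.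
  exact: (cvg_unique _ h1 h5).
rewrite (_ : (fun k => _) = EFin \o (fun k => s ^+ 2 * \int[mu]_(x in I k) (pdf x) -
  2 * s ^+ 2 * (k%:R * pdf k%:R))); last by apply/funext => k; rewrite EI int_I_sq.
apply: cvg_EFin; first by apply: nearW.
rewrite /= [X in _ --> X](_ : _ = s ^+ 2 * 1 - 2 * s ^+ 2 * 0); last by rewrite mulr1 mulr0 subr0.
by apply: cvgB; apply: cvgM => //; exact: cvg_cst.
Qed.

Lemma normal_integrable_id : N.-integrable [set: R] (EFin \o id).
Proof.
apply/integrableP; split; first exact/measurable_EFinP.
apply: (@le_lt_trans _ _ (\int[N]_x (1 + x ^+ 2)%:E)%E).
  apply: ge0_le_integral => //=.
  - by apply/measurable_EFinP; exact: normr_measurable.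
  - by apply/measurable_EFinP; apply: measurable_funD => //; exact: exprn_measurable.
  - move=> x _; rewrite lee_fin -[x ^+ 2]real_normK ?num_real//.
    by have := sqr_ge0 (`|x| - 1); have := normr_ge0 x; nra.
under eq_integral do rewrite EFinD.
rewrite ge0_integralD//=.
- by rewrite normal_second_moment integral_cst//= probability_setT mule1 -EFinD ltry.
- by move=> x _; rewrite lee_fin sqr_ge0.
- by apply/measurable_EFinP; exact: exprn_measurable.
Qed.

(** The integrals of the positive and of the negative part of x are limits of
    integrals over [-k, k], where they agree since pdf is even. *)
Lemma normal_mean : (\int[N]_x x%:E = 0)%E.
Proof.
have mid : measurable_fun [set: R] (fun x : R => x%:E) by exact/measurable_EFinP.
have P (u : R -> R) : continuous u -> (forall x, 0 <= u x) -> (forall x, u x <= `|x|) ->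
  exists r : R, (\int[N]_x (u x)%:E = r%:E)%E /\ (\int[mu]_(x in I k) (u x * pdf x)) @[k --> \oo] --> r.
  move=> cu u0 ux.
  have mu_ : measurable_fun [set: R] u by exact: continuous_measurable_fun.
  have Efin : (\int[N]_x (u x)%:E \is a fin_num)%E.
    rewrite ge0_fin_numE; last by apply: integral_ge0 => x _; rewrite lee_fin.
    have /integrableP[_] := normal_integrable_id; apply: le_lt_trans.
    apply: ge0_le_integral => //=.
    - by move=> x _; rewrite lee_fin.
    - exact/measurable_EFinP.
    - change (measurable_fun [set: R] (EFin \o (Num.norm : R -> R))).
      by apply/measurable_EFinP; exact: normr_measurable.
    - by move=> x _; rewrite lee_fin.
  have EN : (\int[N]_x (u x)%:E = \int[mu]_x (u x * pdf x)%:E)%E.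
    rewrite ge0_integral_normal//; first exact/measurable_EFinP.
  exists (fine (\int[N]_x (u x)%:E)); rewrite fineK//; split=> //.
  apply: fine_cvg; rewrite fineK// EN; apply: cvg_I.
    by move=> x; apply: cvgM; [exact: cu|exact: cp].
  by move=> x; rewrite mulr_ge0// normal_pdf_ge0.
have cu : continuous (fun x : R => (`|x| + x) / 2).
  by move=> x; apply: cvgM; [apply: cvgD; [exact: norm_continuous|exact: cvg_id]|exact: cvg_cst].
have cv : continuous (fun x : R => (`|x| - x) / 2).
  by move=> x; apply: cvgM; [apply: cvgB; [exact: norm_continuous|exact: cvg_id]|exact: cvg_cst].
have xx (x : R) : x <= `|x| /\ - x <= `|x| by rewrite -normrN ler_norm normrN ler_norm.
have [||r [Er cr]] := P _ cu; try by move=> x; have [] := xx x; lra.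
have [||q [Eq cq]] := P _ cv; try by move=> x; have [] := xx x; lra.
have rq : r = q.
  have h := cvgB cr cq; apply/eqP; rewrite -subr_eq0; apply/eqP.
  suff h0 : (fun k => \int[mu]_(x in I k) ((`|x| + x) / 2 * pdf x)) -
       (fun k => \int[mu]_(x in I k) ((`|x| - x) / 2 * pdf x)) = fun=> 0.
    rewrite h0 in h; have h1 : (fun k : nat => 0 : R) @ \oo --> (0 : R) by exact: cvg_cst.
    exact: (cvg_unique _ (h _) h1).
  apply/funext => k.
  change (\int[mu]_(x in I k) ((`|x| + x) / 2 * pdf x) -
    \int[mu]_(x in I k) ((`|x| - x) / 2 * pdf x) = 0).
  rewrite -RintegralB//.
  - rewrite -[RHS](int_I_id k); apply: eq_Rintegral => x _.
    by rewrite -mulrBl; congr (_ * _); lra.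
  - exact: measurable_itv.
  - by apply: integrable_cont => x; apply: cvgM; [exact: cu|exact: cp].
  - by apply: integrable_cont => x; apply: cvgM; [exact: cv|exact: cp].
rewrite integralE /= [X in (X - _)%E](_ : _ = r%:E); last first.
  rewrite -Er; apply: eq_integral => x _; rewrite funeposE -EFin_max; congr (_%:E).
  by case: (leP x 0) => h; rewrite ?(ler0_norm h) ?(gtr0_norm h); lra.
rewrite [X in (_ - X)%E](_ : _ = q%:E); last first.
  rewrite -Eq; apply: eq_integral => x _; rewrite funenegE -EFinN -EFin_max; congr (_%:E).
  by case: (leP (- x) 0) => h; case: (leP x 0) => h'; rewrite ?(ler0_norm h') ?(gtr0_norm h'); lra.
by rewrite rq -EFinB subrr.
Qed.
End Gauss.

(** * Square-integrable random variables and products of independent ones *)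

Section L2.
Context {d : measure_display} {T : measurableType d} {R : realType}.
Variable P : probability T R.
Implicit Types X Y : T -> R.

Definition intble X := P.-integrable [set: T] (EFin \o X).
Definition sqintble X := measurable_fun [set: T] X /\ intble (fun w => X w ^+ 2).

Lemma intble_le X Y : measurable_fun [set: T] X -> (forall w, `|X w| <= Y w) ->
  intble Y -> intble X.
Proof.
move=> mX XY iY; apply: le_integrable iY => //; first exact/measurable_EFinP.
by move=> w _; rewrite lee_fin (le_trans (XY w))// ler_norm.
Qed.

Lemma intble_measurable X : intble X -> measurable_fun [set: T] X.
Proof. by move=> /measurable_int /measurable_EFinP. Qed.

Lemma intbleD X Y : intble X -> intble Y -> intble (fun w => X w + Y w).
Proof. by move=> iX iY; have := integrableD measurableT iX iY. Qed.

Lemma intbleZ c X : intble X -> intble (fun w => c * X w).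
Proof. by move=> iX; have := integrableZl measurableT c iX. Qed.

Lemma intble_cst (c : R) : intble (fun=> c).
Proof. exact: finite_measure_integrable_cst. Qed.

Lemma intble_sum (I : Type) (r : seq I) (f : I -> T -> R) :
  (forall i, intble (f i)) -> intble (fun w => \sum_(i <- r) f i w).
Proof. exact: integrable_sumr. Qed.

Lemma Rint_sum (I : Type) (r : seq I) (f : I -> T -> R) :
  (forall i, intble (f i)) ->
  \int[P]_w (\sum_(i <- r) f i w) = \sum_(i <- r) \int[P]_w f i w.
Proof. exact: Rintegral_sumr. Qed.

Lemma sqintble_mul X Y : sqintble X -> sqintble Y -> intble (fun w => X w * Y w).
Proof.
move=> [mX iX] [mY iY]; apply: (@intble_le _ (fun w => X w ^+ 2 + Y w ^+ 2)).
- exact: measurable_funM.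
- move=> w; rewrite normrM -[X w ^+ 2]real_normK ?num_real// -[Y w ^+ 2]real_normK ?num_real//.
  by have := sqr_ge0 (`|X w| - `|Y w|); have := normr_ge0 (X w); have := normr_ge0 (Y w); nra.
- exact: intbleD.
Qed.

Lemma sqintbleZ c X : sqintble X -> sqintble (fun w => c * X w).
Proof.
move=> [mX iX]; split; first exact: measurable_funM.
by under eq_fun do rewrite exprMn; exact: intbleZ.
Qed.

Lemma sqintbleD X Y : sqintble X -> sqintble Y -> sqintble (fun w => X w + Y w).
Proof.
move=> sX sY; have iXY := sqintble_mul sX sY; case: sX sY => mX iX [mY iY].
split; first exact: measurable_funD.
rewrite (_ : (fun w => _) = fun w => X w ^+ 2 + 2 * (X w * Y w) + Y w ^+ 2).
  by apply: intbleD => //; apply: intbleD => //; exact: intbleZ.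
by apply/funext => w; ring.
Qed.

Lemma sqintbleB X Y : sqintble X -> sqintble Y -> sqintble (fun w => X w - Y w).
Proof.
move=> sX sY; rewrite (_ : (fun w => _) = fun w => X w + (-1) * Y w).
  by apply: sqintbleD => //; exact: sqintbleZ.
by apply/funext => w; ring.
Qed.

Lemma sqintble_cst (c : R) : sqintble (fun=> c).
Proof. by split; [exact: measurable_cst|exact: intble_cst]. Qed.

Lemma sqintble_sum (I : Type) (r : seq I) (f : I -> T -> R) :
  (forall i, sqintble (f i)) -> sqintble (fun w => \sum_(i <- r) f i w).
Proof.
move=> H; elim: r => [|i r IH].
  by rewrite (_ : (fun w => _) = fun=> 0); [exact: sqintble_cst|apply/funext => w; rewrite big_nil].
rewrite (_ : (fun w => _) = fun w => f i w + \sum_(j <- r) f j w); first exact: sqintbleD.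
by apply/funext => w; rewrite big_cons.
Qed.

Lemma sqintble_intble X : sqintble X -> intble X.
Proof.
move=> sX; have := sqintble_mul sX (sqintble_cst 1).
by under eq_fun do rewrite mulr1.
Qed.

Lemma sqintble_bounded X M : measurable_fun [set: T] X -> (forall w, `|X w| <= M) -> sqintble X.
Proof.
move=> mX XM; split=> //; apply: (@intble_le _ (fun=> M ^+ 2)).
- exact: measurable_funX.
- by move=> w; rewrite normrX lerXn2r ?nnegrE// (le_trans _ (XM w)).
- exact: intble_cst.
Qed.

Lemma expectE X : intble X -> ('E_P[X] = (\int[P]_w X w)%:E)%E.
Proof. by move=> iX; rewrite unlock /Rintegral fineK// integrable_fin_num. Qed.

Lemma expect_sq_sqintble X : measurable_fun [set: T] X ->
  ('E_P[fun w => (X w ^+ 2)%R] < +oo)%E -> sqintble X.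
Proof.
move=> mX fX; split=> //; apply/integrableP; split.
  by apply/measurable_EFinP; exact: measurable_funX.
move: fX; rewrite unlock; apply: le_lt_trans; rewrite le_eqVlt; apply/orP; left; apply/eqP.
by apply: eq_integral => w _ /=; rewrite ger0_norm ?sqr_ge0.
Qed.

Lemma Rint_ge0 X : (forall w, 0 <= X w) -> 0 <= \int[P]_w X w.
Proof. by move=> X0; apply: Rintegral_ge0 => w _. Qed.

Lemma Rint_le X Y : intble X -> intble Y -> (forall w, X w <= Y w) ->
  \int[P]_w X w <= \int[P]_w Y w.
Proof. by move=> iX iY XY; apply: le_Rintegral => // w _. Qed.

Lemma Rint_cst (c : R) : \int[P]_w c = c.
Proof. by rewrite Rintegral_cst//= probability_setT mulr1. Qed.

Lemma Rint_sqD X Y : sqintble X -> sqintble Y ->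
  \int[P]_w ((X w + Y w) ^+ 2) =
  \int[P]_w (X w ^+ 2) + 2 * \int[P]_w (X w * Y w) + \int[P]_w (Y w ^+ 2).
Proof.
move=> sX sY; have iXY := sqintble_mul sX sY; case: sX sY => mX iX [mY iY].
have iZ := intbleZ 2 iXY; have iS := intbleD iX iZ.
rewrite -RintegralZl// -(RintegralD measurableT iX iZ) -(RintegralD measurableT iS iY).
by apply: eq_Rintegral => w _; ring.
Qed.

(** A measure on the product is determined by its values on rectangles, so the
    joint law is the product of the laws and Tonelli applies. *)
Lemma ge0_integral_indep d1 (T1 : measurableType d1) (X : T -> T1) (Y : T -> R)
    (f : T1 -> R) (g : R -> R) :
  measurable_fun [set: T] X -> measurable_fun [set: T] Y ->
  (forall A B, measurable A -> measurable B ->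
     P (X @^-1` A `&` Y @^-1` B) = P (X @^-1` A) * P (Y @^-1` B))%E ->
  measurable_fun [set: T1] f -> measurable_fun [set: R] g ->
  (forall x, 0 <= f x) -> (forall y, 0 <= g y) ->
  (\int[P]_w (f (X w) * g (Y w))%:E =
   (\int[P]_w (f (X w))%:E) * (\int[P]_w (g (Y w))%:E))%E.
Proof.
move=> mX mY XY mf mg f0 g0.
pose X' : {mfun T >-> T1} := HB.pack X (isMeasurableFun.Build _ _ _ _ X mX).
pose Y' : {mfun T >-> R} := HB.pack Y (isMeasurableFun.Build _ _ _ _ Y mY).
have mXY : measurable_fun [set: T] (fun w => (X' w, Y' w)) by exact: measurable_fun_pair.
pose XY' : {mfun T >-> (T1 * R)%type} := HB.pack (fun w => (X' w, Y' w))
  (isMeasurableFun.Build _ _ _ _ (fun w => (X' w, Y' w)) mXY).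
pose m1 := distribution P X'; pose m2 := distribution P Y'.
pose h (z : T1 * R) := (f z.1 * g z.2)%:E.
have mh : measurable_fun [set: T1 * R] h.
  apply/measurable_EFinP; apply: measurable_funM.
    by apply: measurableT_comp => //; exact: measurable_fst.
  by apply: (@measurableT_comp _ _ _ _ _ _ g) => //; exact: measurable_snd.
have h0 z : (0 <= h z)%E by rewrite lee_fin mulr_ge0.
transitivity (\int[distribution P XY']_z h z)%E.
  by rewrite ge0_integral_distribution.
transitivity (\int[(m1 \x m2)%E]_z h z)%E.
  apply: eq_measure_integral => A mA _; apply/esym.
  by apply: product_measure_unique => // B C mB mC; exact: XY.
rewrite fubini_tonelli1// /fubini_F /=.
have gY : (\int[m2]_y (g y)%:E = \int[P]_w (g (Y w))%:E)%E.
  by rewrite ge0_integral_distribution//; exact/measurable_EFinP.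
have g0' : (0 <= \int[m2]_y (g y)%:E)%E by apply: integral_ge0 => y _; rewrite lee_fin.
transitivity (\int[m1]_x ((f x)%:E * \int[m2]_y (g y)%:E))%E.
  apply: eq_integral => x _; rewrite /h/=; under eq_integral do rewrite EFinM.
  by rewrite ge0_integralZl_EFin//; [move=> y _; rewrite lee_fin|exact/measurable_EFinP].
rewrite ge0_integralZr//; [|exact/measurable_EFinP|by move=> x _; rewrite lee_fin].
by rewrite gY; congr (_ * _)%E; rewrite ge0_integral_distribution//; exact/measurable_EFinP.
Qed.

(** Integrability of the product is the nonnegative case for the absolute
    values; the formula follows by splitting both factors into positive and
    negative parts. *)
Lemma indep_mul d1 (T1 : measurableType d1) (X : T -> T1) (Y : T -> R)
    (f : T1 -> R) (g : R -> R) :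
  measurable_fun [set: T] X -> measurable_fun [set: T] Y ->
  (forall A B, measurable A -> measurable B ->
     P (X @^-1` A `&` Y @^-1` B) = P (X @^-1` A) * P (Y @^-1` B))%E ->
  measurable_fun [set: T1] f -> measurable_fun [set: R] g ->
  intble (fun w => f (X w)) -> intble (fun w => g (Y w)) ->
  intble (fun w => f (X w) * g (Y w)) /\
  \int[P]_w (f (X w) * g (Y w)) = (\int[P]_w f (X w)) * (\int[P]_w g (Y w)).
Proof.
move=> mX mY XY mf mg iX iY.
have mfX : measurable_fun [set: T] (fun w => f (X w)) by exact: measurableT_comp.
have mgY : measurable_fun [set: T] (fun w => g (Y w)).
  by apply: (@measurableT_comp _ _ _ _ _ _ g).
have mfg : measurable_fun [set: T] (fun w => f (X w) * g (Y w)) by exact: measurable_funM.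
have I2 : intble (fun w => f (X w) * g (Y w)).
  apply/integrableP; split; first exact/measurable_EFinP.
  have := @ge0_integral_indep _ T1 X Y (fun x => `|f x|) (fun y => `|g y|) mX mY XY.
  move=> /(_ (measurableT_comp (@normr_measurable R setT) mf)).
  move=> /(_ (measurableT_comp (@normr_measurable R setT) mg)).
  move=> /(_ (fun x => normr_ge0 _) (fun y => normr_ge0 _)) => H.
  under eq_integral do rewrite /= normrM.
  rewrite H; case/integrableP: iX => _ iX; case/integrableP: iY => _ iY.
  by rewrite lte_mul_pinfty// ?ge0_fin_numE// integral_ge0.
split=> //.
pose p (u : R) := (`|u| + u) / 2; pose q (u : R) := (`|u| - u) / 2.
have p0 u : 0 <= p u by rewrite /p; have := ler_norm (- u); rewrite normrN; lra.
have q0 u : 0 <= q u by rewrite /q; have := ler_norm u; lra.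
have mp : measurable_fun [set: R] p.
  by apply: measurable_funM => //; apply: measurable_funD => //; exact: normr_measurable.
have mq : measurable_fun [set: R] q.
  by apply: measurable_funM => //; apply: measurable_funB => //; exact: normr_measurable.
have ip (U : T -> R) : intble U -> intble (fun w => p (U w)).
  move=> iU; apply: (@intble_le _ (fun w => `|U w|)).
  - by apply: (@measurableT_comp _ _ _ _ _ _ p) => //; exact: intble_measurable.
  - by move=> w; rewrite ger0_norm// /p; have := ler_norm (U w); lra.
  - by have := integrable_norm iU.
have iq (U : T -> R) : intble U -> intble (fun w => q (U w)).
  move=> iU; apply: (@intble_le _ (fun w => `|U w|)).
  - by apply: (@measurableT_comp _ _ _ _ _ _ q) => //; exact: intble_measurable.
  - by move=> w; rewrite ger0_norm// /q; have := ler_norm (- U w); rewrite normrN; lra.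
  - by have := integrable_norm iU.
have K (u v : R -> R) : measurable_fun [set: R] u -> measurable_fun [set: R] v ->
    (forall x, 0 <= u x <= `|x|) -> (forall x, 0 <= v x <= `|x|) ->
    intble (fun w => u (f (X w))) -> intble (fun w => v (g (Y w))) ->
    intble (fun w => u (f (X w)) * v (g (Y w))) /\
    \int[P]_w (u (f (X w)) * v (g (Y w))) = \int[P]_w u (f (X w)) * \int[P]_w v (g (Y w)).
  move=> mu mv u0 v0 iu iv.
  have := @ge0_integral_indep _ T1 X Y (u \o f) (v \o g) mX mY XY.
  move=> /(_ (measurableT_comp mu mf) (measurableT_comp mv mg)) => H.
  have u0' x : 0 <= u x by have /andP[] := u0 x.
  have v0' x : 0 <= v x by have /andP[] := v0 x.
  split.
    apply: (@intble_le _ (fun w => `|f (X w) * g (Y w)|)); last by have := integrable_norm I2.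
      by apply: measurable_funM; [apply: (@measurableT_comp _ _ _ _ _ _ u)|apply: (@measurableT_comp _ _ _ _ _ _ v)].
    move=> w; rewrite !normrM; apply: ler_pM => //; rewrite ger0_norm//.
      by have /andP[] := u0 (f (X w)).
    by have /andP[] := v0 (g (Y w)).
  rewrite /Rintegral H//= fineM// ; exact: integrable_fin_num.
have pq x : x = p x - q x by rewrite /p /q; lra.
have pb x : 0 <= p x <= `|x| by rewrite p0 /p; have := ler_norm x; lra.
have qb x : 0 <= q x <= `|x| by rewrite q0 /q; have := ler_norm (- x); rewrite normrN; lra.
have [ipp Epp] := K p p mp mp pb pb (ip _ iX) (ip _ iY).
have [ipq Epq] := K p q mp mq pb qb (ip _ iX) (iq _ iY).
have [iqp Eqp] := K q p mq mp qb pb (iq _ iX) (ip _ iY).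
have [iqq Eqq] := K q q mq mq qb qb (iq _ iX) (iq _ iY).
have EX : \int[P]_w f (X w) = \int[P]_w p (f (X w)) - \int[P]_w q (f (X w)).
  rewrite -(RintegralB measurableT (ip _ iX) (iq _ iX)).
  by apply: eq_Rintegral => w _; rewrite -pq.
have EY : \int[P]_w g (Y w) = \int[P]_w p (g (Y w)) - \int[P]_w q (g (Y w)).
  rewrite -(RintegralB measurableT (ip _ iY) (iq _ iY)).
  by apply: eq_Rintegral => w _; rewrite -pq.
rewrite EX EY mulrBl !mulrBr -Epp -Epq -Eqp -Eqq opprB.
have i1 : intble (fun w => p (f (X w)) * p (g (Y w)) - p (f (X w)) * q (g (Y w))).
  by have := integrableB measurableT ipp ipq.
have i2 : intble (fun w => q (f (X w)) * q (g (Y w)) - q (f (X w)) * p (g (Y w))).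
  by have := integrableB measurableT iqq iqp.
rewrite -(RintegralB measurableT ipp ipq) -(RintegralB measurableT iqq iqp).
rewrite -(RintegralD measurableT i1 i2).
by apply: eq_Rintegral => w _; rewrite {1}[f (X w)]pq {1}[g (Y w)]pq; ring.
Qed.

End L2.

(** * Mean-square convergence and expansions in an orthonormal family *)

Section Cvg0.
Context {R : realType}.
Implicit Types u v : nat -> R.

Lemma cvg0_ex u : u @ \oo --> (0 : R) ->
  forall e, 0 < e -> exists N0, forall N, (N0 <= N)%N -> u N <= e.
Proof.
move=> u0 e e0; have /cvgr0Pnorm_le/(_ _ e0) := u0.
move=> [N0 _ H]; exists N0 => N NN; apply: le_trans (ler_norm _) _.
exact: H.
Qed.

Lemma ex_cvg0 u : (forall N, 0 <= u N) ->
  (forall e, 0 < e -> exists N0, forall N, (N0 <= N)%N -> u N <= e) ->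
  u @ \oo --> (0 : R).
Proof.
move=> u0 H; apply/cvgr0Pnorm_le => e e0; have [N0 HN] := H e e0.
by exists N0 => // N NN /=; rewrite ger0_norm//; exact: HN.
Qed.

End Cvg0.

Section Hilbert.
Context {d : measure_display} {T : measurableType d} {R : realType}.
Variable P : probability T R.
Implicit Types X Y : T -> R.

Definition moment2 X : R := \int[P]_w (X w ^+ 2).

Lemma moment2_ge0 X : 0 <= moment2 X.
Proof. by apply: Rint_ge0 => w; exact: sqr_ge0. Qed.

Lemma moment2Z c X : sqintble P X -> moment2 (fun w => c * X w) = c ^+ 2 * moment2 X.
Proof.
move=> [_ iX]; rewrite /moment2 -RintegralZl//; apply: eq_Rintegral => w _; exact: exprMn.
Qed.

Lemma eq_moment2 X Y : X =1 Y -> moment2 X = moment2 Y.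
Proof. by move=> XY; apply: eq_Rintegral => w _; rewrite XY. Qed.

(** From 0 <= (e X - Y)^2 / e.  A small e gives continuity of second moments,
    e = 1 a triangle inequality with the constant 2. *)
Lemma moment2_young (e : R) X Y : 0 < e -> sqintble P X -> sqintble P Y ->
  moment2 (fun w => X w + Y w) <= (1 + e) * moment2 X + (1 + e^-1) * moment2 Y.
Proof.
move=> e0 sX sY; have iXY := sqintbleD sX sY; case: (sX) => mX iX; case: (sY) => mY iY.
have i1 := intbleZ (1 + e) iX; have i2 := intbleZ (1 + e^-1) iY.
rewrite /moment2 -!RintegralZl// -(RintegralD measurableT i1 i2); apply: Rint_le.
- by case: iXY.
- exact: intbleD.
move=> w; have := sqr_ge0 (e * X w - Y w) => h.
have : 0 <= e^-1 * (e * X w - Y w) ^+ 2 by rewrite mulr_ge0// invr_ge0 ltW.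
move=> h2; rewrite -subr_ge0; apply: le_trans h2 _; rewrite le_eqVlt; apply/orP; left; apply/eqP.
by field; rewrite gt_eqF.
Qed.

Lemma moment2_le2 X Y : sqintble P X -> sqintble P Y ->
  moment2 (fun w => X w + Y w) <= 2 * (moment2 X + moment2 Y).
Proof.
by move=> sX sY; have := moment2_young ltr01 sX sY; rewrite invr1; lra.
Qed.

Lemma moment2_sum_cvg0 (I : Type) (r : seq I) (f : I -> nat -> T -> R) :
  (forall i N, sqintble P (f i N)) ->
  (forall i, moment2 (f i N) @[N --> \oo] --> (0 : R)) ->
  moment2 (fun w => \sum_(i <- r) f i N w) @[N --> \oo] --> (0 : R).
Proof.
move=> sf H; elim: r => [|i r IH].
  rewrite (_ : (fun N => _) = fun=> 0); first exact: cvg_cst.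
  apply/funext => N; rewrite /moment2; under eq_Rintegral do rewrite big_nil expr0n/=.
  exact: Rint_cst.
apply: (@squeeze_cvgr _ _ _ _ (fun=> 0) (fun N => 2 * (moment2 (f i N) + moment2 (fun w => \sum_(i <- r) f i N w)))).
- apply: nearW => N; rewrite moment2_ge0/=.
  rewrite (@eq_moment2 _ (fun w => f i N w + \sum_(j <- r) f j N w)).
    by apply: moment2_le2 => //; exact: sqintble_sum.
  by move=> w; rewrite big_cons.
- exact: cvg_cst.
- rewrite [X in _ --> X](_ : _ = 2 * (0 + 0)); last by rewrite addr0 mulr0.
  by apply: cvgM; [exact: cvg_cst|exact: cvgD].
Qed.

Lemma moment2_cvg X (Xn : nat -> T -> R) : sqintble P X -> (forall N, sqintble P (Xn N)) ->
  moment2 (fun w => X w - Xn N w) @[N --> \oo] --> (0 : R) ->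
  moment2 (Xn N) @[N --> \oo] --> moment2 X.
Proof.
move=> sX sXn H; apply/cvgrPdist_le => /= e e0.
have x0 := moment2_ge0 X.
pose dl := Num.min 1 (e / (8 * (moment2 X + 1))).
have dl0 : 0 < dl by rewrite lt_min ltr01 divr_gt0// mulr_gt0//; lra.
have dl1 : dl <= 1 by rewrite ge_min lexx.
have dle : dl * (moment2 X + 1) <= e / 8.
  have : dl <= e / (8 * (moment2 X + 1)) by rewrite ge_min lexx orbT.
  rewrite ler_pdivlMr; last lra.
  by lra.
pose eta := Num.min 1 (e / (4 * (1 + dl^-1))).
have di0 : 0 < dl^-1 by rewrite invr_gt0.
have eta0 : 0 < eta by rewrite lt_min ltr01 divr_gt0//; lra.
have eta1 : eta <= 1 by rewrite ge_min lexx.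
have etae : (1 + dl^-1) * eta <= e / 4.
  have : eta <= e / (4 * (1 + dl^-1)) by rewrite ge_min lexx orbT.
  rewrite ler_pdivlMr; last lra.
  by lra.
have [N0 HN] := cvg0_ex H eta0.
exists N0 => // N /= /HN {}HN.
have sD := sqintbleB sX (sXn N).
have h1 : moment2 X <= (1 + dl) * moment2 (Xn N) + (1 + dl^-1) * moment2 (fun w => X w - Xn N w).
  rewrite (@eq_moment2 X (fun w => Xn N w + (X w - Xn N w))); last by move=> w; ring.
  exact: moment2_young.
have ED : moment2 (fun w => -1 * (X w - Xn N w)) = moment2 (fun w => X w - Xn N w).
  by rewrite moment2Z// sqrrN expr1n mul1r.
have sD' := sqintbleZ (-1) sD.
have h2 : moment2 (Xn N) <= (1 + dl) * moment2 X + (1 + dl^-1) * moment2 (fun w => X w - Xn N w).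
  rewrite (@eq_moment2 (Xn N) (fun w => X w + -1 * (X w - Xn N w))); last by move=> w; ring.
  by rewrite -ED; exact: moment2_young.
have h3 : (1 + dl^-1) * moment2 (fun w => X w - Xn N w) <= e / 4.
  by apply: le_trans etae; rewrite ler_wpM2l// addr_ge0// ltW.
have h4 : dl * moment2 (Xn N) <= dl * ((1 + dl) * moment2 X) + dl * (e / 4).
  by rewrite -mulrDr; apply: ler_wpM2l; [exact: ltW|lra].
have h7 : 0 <= dl * moment2 X by rewrite mulr_ge0// ltW.
have h5 : dl * ((1 + dl) * moment2 X) <= 2 * (dl * moment2 X).
  by rewrite mulrCA ler_wpM2r//; lra.
have h6 : dl * (e / 4) <= e / 4 by rewrite ler_piMl//; lra.
have h8 : dl * moment2 X <= e / 8 by lra.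
by rewrite ler_norml; lra.
Qed.

Section Orthonormal.
Variables (n : nat) (Z : nat -> 'I_n -> T -> R).
Hypothesis sZ : forall k b, sqintble P (Z k b).
Hypothesis oZ : forall k b l c, \int[P]_w (Z k b w * Z l c w) = ((k == l) && (b == c))%:R.
Hypothesis zZ : forall k b, \int[P]_w Z k b w = 0.

Definition chaos (c : nat -> 'I_n -> R) K w := \sum_(k < K) \sum_b c k b * Z k b w.

Lemma sqintble_chaos c K : sqintble P (chaos c K).
Proof. by apply: sqintble_sum => k; apply: sqintble_sum => b; exact: sqintbleZ. Qed.

Lemma moment2_chaos c K : moment2 (chaos c K) = \sum_(k < K) \sum_b c k b ^+ 2.
Proof.
pose X (p : 'I_K * 'I_n) w := c p.1 p.2 * Z p.1 p.2 w.
have sX p : sqintble P (X p) by exact: sqintbleZ.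
rewrite /moment2 (@eq_Rintegral _ _ _ _ _ (fun w => \sum_p \sum_q (X p w * X q w))); last first.
  move=> w _; rewrite /chaos pair_bigA/= expr2 mulr_suml; apply: eq_bigr => p _.
  by rewrite mulr_sumr.
rewrite Rint_sum; last by move=> p; apply: intble_sum => q; exact: sqintble_mul.
rewrite pair_bigA/=; apply: eq_bigr => p _.
rewrite Rint_sum; last by move=> q; exact: sqintble_mul.
have E q : \int[P]_w (X p w * X q w) = c p.1 p.2 * c q.1 q.2 * (p == q)%:R.
  rewrite (_ : (p == q) = (val p.1 == val q.1) && (p.2 == q.2)); last first.
    by case: p q {sX} => [a b] [a' b'].
  rewrite -oZ -RintegralZl//; last exact: sqintble_mul.
  by apply: eq_Rintegral => w _; rewrite /X; ring.
rewrite (bigD1 p)//= big1 ?addr0 ?E ?eqxx ?mulr1 ?expr2// => q qp.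
by rewrite E eq_sym (negbTE qp) mulr0.
Qed.

Lemma chaos_mean c K : \int[P]_w chaos c K w = 0.
Proof.
rewrite Rint_sum; last by move=> k; apply: intble_sum => b; apply: intbleZ; exact: sqintble_intble.
rewrite big1// => k _; rewrite Rint_sum; last by move=> b; apply: intbleZ; exact: sqintble_intble.
by rewrite big1// => b _; rewrite RintegralZl ?zZ ?mulr0//; exact: sqintble_intble.
Qed.

Lemma moment2_cst_chaos x c K :
  moment2 (fun w => x + chaos c K w) = x ^+ 2 + \sum_(k < K) \sum_b c k b ^+ 2.
Proof.
rewrite /moment2 Rint_sqD; [|exact: sqintble_cst|exact: sqintble_chaos].
rewrite Rint_cst -/(moment2 _) moment2_chaos RintegralZl//; last exact/sqintble_intble/sqintble_chaos.
by rewrite chaos_mean !mulr0 addr0.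
Qed.

Lemma chaosB c c' K w :
  chaos c K w - chaos c' K w = chaos (fun k b => c k b - c' k b) K w.
Proof.
rewrite /chaos -sumrB; apply: eq_bigr => k _; rewrite -sumrB.
by apply: eq_bigr => b _; rewrite mulrBl.
Qed.

Lemma sum_sq_homo (c : nat -> 'I_n -> R) K K' : (K <= K')%N ->
  \sum_(k < K) \sum_b c k b ^+ 2 <= \sum_(k < K') \sum_(b < n) c k b ^+ 2 :> R.
Proof.
move=> KK; rewrite -!(big_mkord xpredT (fun k => \sum_(b < n) c k b ^+ 2)).
rewrite (big_cat_nat (leq0n K) KK)//= lerDl; apply: sumr_ge0 => k _; apply: sumr_ge0 => b _.
exact: sqr_ge0.
Qed.

(** By orthonormality and the triangle inequality through U N, J and U M, the
    coefficients cN N and cN M are close in l^2 for large N and M.  Letting M grow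
    bounds the l^2 distance from cN N to c uniformly in the length of the sums, so
    one fixed N0 serves as intermediate point between J and all long partial sums
    for c. *)
Lemma chaos_limit (J : T -> R) (U : nat -> T -> R) (cN : nat -> nat -> 'I_n -> R) c :
  sqintble P J -> (forall N, sqintble P (U N)) ->
  (forall N, moment2 (fun w => U N w - chaos (cN N) K w) @[K --> \oo] --> (0 : R)) ->
  moment2 (fun w => J w - U N w) @[N --> \oo] --> (0 : R) ->
  (forall k b, cN N k b @[N --> \oo] --> c k b) ->
  moment2 (fun w => J w - chaos c K w) @[K --> \oo] --> (0 : R).
Proof.
move=> sJ sU H1 H2 H3; apply: ex_cvg0; first by move=> K; exact: moment2_ge0.
(* the errors below add up to 70 e *)
move=> e0 e00; pose e := e0 / 100.
have ep : 0 < e by rewrite divr_gt0.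
have [N0 HN0] := cvg0_ex H2 ep.
have cau K N M : (N0 <= N)%N -> (N0 <= M)%N ->
    \sum_(k < K) \sum_b (cN N k b - cN M k b) ^+ 2 <= 16 * e.
  move=> /HN0 hN /HN0 hM.
  have [K1 HK1] := cvg0_ex (H1 N) ep; have [K2 HK2] := cvg0_ex (H1 M) ep.
  (* K is enlarged to K' so that both expansions are accurate; the partial sum
    of squares up to K is at most the one up to K'. *)
  pose K' := maxn K (maxn K1 K2).
  have KK' : (K <= K')%N by rewrite leq_maxl.
  apply: (le_trans (sum_sq_homo (fun k b => cN N k b - cN M k b) KK')).
  rewrite -(moment2_chaos (fun k b => cN N k b - cN M k b) K').
  have h1 := HK1 K'; have h2 := HK2 K'.
  have {}h1 := h1 (leq_trans (leq_maxl _ _) (leq_maxr _ _)).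
  have {}h2 := h2 (leq_trans (leq_maxr _ _) (leq_maxr _ _)).
  have sA := sqintbleB (sU N) (sqintble_chaos (cN N) K').
  have sB := sqintbleB (sU M) (sqintble_chaos (cN M) K').
  have sC := sqintbleB sJ (sU N); have sD := sqintbleB sJ (sU M).
  have s1 := sqintbleD (sqintbleZ (-1) sA) (sqintbleZ (-1) sC).
  have s2 := sqintbleD sD sB.
  rewrite (@eq_moment2 _ (fun w => (-1 * (U N w - chaos (cN N) K' w) + -1 * (J w - U N w)) +
     ((J w - U M w) + (U M w - chaos (cN M) K' w)))); last first.
    by move=> w; rewrite -chaosB; ring.
  apply: (le_trans (moment2_le2 s1 s2)).
  have := moment2_le2 (sqintbleZ (-1) sA) (sqintbleZ (-1) sC); have := moment2_le2 sD sB.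
  by rewrite !moment2Z// sqrrN expr1n !mul1r; lra.
have cau' K : \sum_(k < K) \sum_b (cN N0 k b - c k b) ^+ 2 <= 16 * e.
  have cv : \sum_(k < K) \sum_b (cN N0 k b - cN M k b) ^+ 2 @[M --> \oo] -->
      \sum_(k < K) \sum_b (cN N0 k b - c k b) ^+ 2.
    apply: cvg_sumr => k; apply: (@cvg_sumr R nat \oo _ _ _ (fun b M => (cN N0 k b - cN M k b) ^+ 2)) => b.
    rewrite expr2; under eq_fun do rewrite expr2.
    by apply: cvgM; apply: cvgB; (try exact: cvg_cst); exact: H3.
  rewrite -(cvg_lim (@Rhausdorff R) cv); apply: limr_le.
    by apply/cvg_ex; eexists; exact: cv.
  by exists N0 => // M /= NM; exact: cau.
have [K0 HK0] := cvg0_ex (H1 N0) ep.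
exists K0 => K /HK0 hK; have hJ := HN0 N0 (leqnn _).
have sA := sqintbleB (sU N0) (sqintble_chaos (cN N0) K).
have sC := sqintbleB sJ (sU N0).
have sE := sqintbleB (sqintble_chaos (cN N0) K) (sqintble_chaos c K).
rewrite (@eq_moment2 _ (fun w => (J w - U N0 w) + ((U N0 w - chaos (cN N0) K w) +
  (chaos (cN N0) K w - chaos c K w)))); last by move=> w; ring.
apply: (le_trans (moment2_le2 sC (sqintbleD sA sE))).
have := moment2_le2 sA sE.
rewrite (@eq_moment2 (fun w => chaos (cN N0) K w - chaos c K w) (chaos (fun k b => cN N0 k b - c k b) K)).
  by rewrite moment2_chaos; have := cau' K; have : e0 = 100 * e; [rewrite /e; field|lra].
by move=> w; rewrite chaosB.
Qed.

End Orthonormal.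
End Hilbert.

(** * Normal random variables and Wiener increments *)

Section GaussRV.
Context {d : measure_display} {T : measurableType d} {R : realType}.
Variable P : probability T R.

Lemma gauss_rv (Y : T -> R) s : 0 < s -> measurable_fun [set: T] Y ->
  (forall C, measurable C -> P (Y @^-1` C) = normal_prob 0 s C) ->
  [/\ sqintble P Y, \int[P]_w Y w = 0 & moment2 P Y = s ^+ 2].
Proof.
move=> s0 mY law.
have mY' : @measurable_fun _ _ T (measurableTypeR R) setT Y by move=> mT C mC; exact: mY.
pose Y' : {mfun T >-> measurableTypeR R} := HB.pack Y (isMeasurableFun.Build _ _ T (measurableTypeR R) Y mY').
have E (f : R -> \bar R) : (\int[distribution P Y']_y f y = \int[normal_prob 0%R s]_y f y)%E.
  by apply: eq_measure_integral => A mA _; exact: law.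
have Esq : (\int[P]_w ((Y w) ^+ 2)%:E = (s ^+ 2)%:E)%E.
  rewrite -(normal_second_moment s0) -E ge0_integral_distribution//.
    by apply/measurable_EFinP; exact: exprn_measurable.
  by move=> y; rewrite lee_fin sqr_ge0.
have sY : sqintble P Y.
  by apply: expect_sq_sqintble => //; rewrite unlock Esq ltry.
split=> //; last by rewrite /moment2 /Rintegral Esq.
rewrite /Rintegral -[0]/(fine 0%E) -(normal_mean s0) -E integral_distribution//.
by have := sqintble_intble sY.
Qed.

Section KL.
Variables (n : nat) (Z : nat -> T -> 'cV[R]_n).
Hypothesis hZ : iid_standard_normal P Z.

Lemma iid_gauss k b : [/\ sqintble P (fun w => Z k.+1 w b 0),
  \int[P]_w Z k.+1 w b 0 = 0 & moment2 P (fun w => Z k.+1 w b 0) = 1].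
Proof.
have [mZ _ law] := hZ; rewrite -[X in moment2 _ _ = X](expr1n R 2).
by apply: gauss_rv => //; [exact: mZ|move=> C mC; exact: law].
Qed.

(** Distinct coordinates are independent and centred, so their product has mean
    zero; on the diagonal stands the variance. *)
Lemma iid_orthonormal k b l c :
  \int[P]_w (Z k.+1 w b 0 * Z l.+1 w c 0) = ((k == l) && (b == c))%:R.
Proof.
have [mZ ind _] := hZ.
have [sX mX oX] := iid_gauss k b; have [sY mY oY] := iid_gauss l c.
have [/andP[/eqP <- /eqP <-]|kl] := boolP ((k == l) && (b == c)).
  by rewrite -oX; apply: eq_Rintegral => w _; rewrite expr2.
pose p := (k.+1, b); pose q := (l.+1, c).
have pq : p != q by apply: contra kl; rewrite /p /q xpair_eqE eqSS.
have indep (A B : set R) : measurable A -> measurable B ->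
    P ((fun w => Z k.+1 w b 0) @^-1` A `&` (fun w => Z l.+1 w c 0) @^-1` B) =
    (P ((fun w => Z k.+1 w b 0%R) @^-1` A) * P ((fun w => Z l.+1 w c 0%R) @^-1` B))%E; last first.
  have [_ ->] := @indep_mul _ _ _ P _ R (fun w => Z k.+1 w b 0) (fun w => Z l.+1 w c 0)
    id id (mZ _ (ltn0Sn k) b) (mZ _ (ltn0Sn l) c) indep (@measurable_id _ _ _) (@measurable_id _ _ _)
    (sqintble_intble sX) (sqintble_intble sY).
  by rewrite mX mul0r.
move=> mA mB.
have := ind [fset p; q]%fset (fun i => if i == p then A else B).
rewrite big_fsetU1 ?inE//= big_seq_fset1 eqxx eq_sym (negbTE pq).
move=> <-.
- congr (P _); apply/seteqP; split=> [w [Aw Bw] i /=|w H].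
    rewrite !inE => /orP[] /eqP ->; first by rewrite eqxx.
    by rewrite eq_sym (negbTE pq).
  split; first by have := H p; rewrite /= !inE !eqxx; exact.
  by have := H q; rewrite /= !inE !eqxx orbT eq_sym (negbTE pq); exact.
- by move=> i /=; rewrite !inE => /orP[] /eqP ->.
- by move=> i; case: ifP.
Qed.

End KL.

Section SigmaSub.
Variable G : set (set T).
Hypothesis sG : sigma_algebra [set: T] G.

(** This identification makes the closure properties of measurable functions
    available for adapted ones. *)
Lemma measurable_wrtP (X : T -> R) : measurable_wrt G X <->
  measurable_fun [set: g_sigma_algebraType G] (X : g_sigma_algebraType G -> R).
Proof.
have E (A : set T) : @measurable _ (g_sigma_algebraType G) A = G A.
  by rewrite /measurable/= (sigma_algebra_id sG).
split=> [mX _ C mC|mX C mC].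
  by rewrite setTI E; exact: mX.
by rewrite -E -[X in measurable X]setTI; exact: mX.
Qed.

End SigmaSub.
End GaussRV.

Section WienerIncr.
Context {d : measure_display} {T : measurableType d} {R : realType}.
Variables (P : probability T R) (n : nat) (F : R -> set (set T)) (W : R -> T -> 'cV[R]_n).
Hypotheses (hF : filtration F) (hW : wiener_process P F W).

Let sF u : 0 <= u <= 1 -> sigma_algebra [set: T] (F u).
Proof. by move=> h; have [/(_ u) H _] := hF; have [] := H h. Qed.

Let Fsub u : 0 <= u <= 1 -> F u `<=` measurable.
Proof. by move=> h; have [/(_ u) H _] := hF; have [] := H h. Qed.

Lemma wrt_measurable u X : 0 <= u <= 1 -> measurable_wrt (F u) X ->
  measurable_fun [set: T] (X : T -> R).
Proof. by move=> h mX _ C mC; rewrite setTI; apply: (Fsub h); exact: mX. Qed.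

Lemma wrt_le s u X : 0 <= s -> s <= u -> u <= 1 ->
  measurable_wrt (F s) X -> measurable_wrt (F u) (X : T -> R).
Proof. by move=> s0 su u1 mX C mC; have [_ H] := hF; apply: (H s u) => //; exact: mX. Qed.

Lemma wrtD u X Y : 0 <= u <= 1 -> measurable_wrt (F u) X -> measurable_wrt (F u) Y ->
  measurable_wrt (F u) (fun w => X w + Y w : R).
Proof.
move=> /sF s /(measurable_wrtP s) mX /(measurable_wrtP s) mY; apply/(measurable_wrtP s).
exact: measurable_funD.
Qed.

Lemma wrtM u X Y : 0 <= u <= 1 -> measurable_wrt (F u) X -> measurable_wrt (F u) Y ->
  measurable_wrt (F u) (fun w => X w * Y w : R).
Proof.
move=> /sF s /(measurable_wrtP s) mX /(measurable_wrtP s) mY; apply/(measurable_wrtP s).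
exact: measurable_funM.
Qed.

Lemma wrt_cst u (c : R) : 0 <= u <= 1 -> measurable_wrt (F u) (fun=> c).
Proof. by move=> /sF s; apply/(measurable_wrtP s); exact: measurable_cst. Qed.

Lemma wiener_wrt u b : 0 <= u <= 1 -> measurable_wrt (F u) (fun w => W u w b 0).
Proof. by move=> h; have [H _ _ _] := hW; exact: H. Qed.

Lemma incr_wrt s u b : 0 <= s -> s <= u -> u <= 1 ->
  measurable_wrt (F u) (fun w => (W u w - W s w) b 0).
Proof.
move=> s0 su u1; have u01 : 0 <= u <= 1 by lra.
rewrite (_ : (fun w => _) = fun w => W u w b 0 + (-1) * W s w b 0); last first.
  by apply/funext => w; rewrite !mxE mulN1r.
apply: wrtD => //; first exact: wiener_wrt.
apply: wrtM => //; first exact: wrt_cst.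
by apply: (@wrt_le s) => //; apply: wiener_wrt; lra.
Qed.

(** Leave all coordinates but b unconstrained. *)
Lemma incr_law s u b (A : set T) (C : set R) : 0 <= s -> s < u -> u <= 1 -> F s A -> measurable C ->
  P (A `&` (fun w => (W u w - W s w) b 0) @^-1` C) = (P A * normal_prob 0%R (Num.sqrt (u - s))%R C)%E.
Proof.
move=> s0 su u1 FA mC; have [_ _ _ H] := hW.
have := H s u A (fun i => if i == b then C else setT) s0 su u1 FA.
rewrite (bigD1 b)//= eqxx big1 ?mule1 => [|i ib]; last by rewrite (negbTE ib) probability_setT.
move=> <-; last by move=> i; case: ifP.
congr (P (_ `&` _)); apply/seteqP; split=> [w Cw i _ /=|w /(_ b Logic.I)/=]; last by rewrite eqxx.
by case: ifP => // /eqP ->.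
Qed.

Lemma incr_gauss s u b : 0 <= s -> s < u -> u <= 1 ->
  [/\ sqintble P (fun w => (W u w - W s w) b 0),
   \int[P]_w (W u w - W s w) b 0 = 0 & moment2 P (fun w => (W u w - W s w) b 0) = u - s].
Proof.
move=> s0 su u1; have us : 0 <= u - s by lra.
rewrite -[X in moment2 _ _ = X](sqr_sqrtr us); apply: gauss_rv.
- by rewrite sqrtr_gt0; lra.
- by apply: (@wrt_measurable u); [lra|apply: incr_wrt => //; exact: ltW].
- move=> C mC; have s01 : 0 <= s <= 1 by lra.
  have FT : F s setT.
    have [F0 FC _] := sF s01; rewrite -[setT](setD0 setT); exact: FC.
  by have := incr_law b s0 su u1 FT mC; rewrite setTI probability_setT mul1e.
Qed.

Lemma incr_indep s u b (X : T -> R) : 0 <= s -> s < u -> u <= 1 -> measurable_wrt (F s) X ->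
  forall A B, measurable A -> measurable B ->
  P (X @^-1` A `&` (fun w => (W u w - W s w) b 0) @^-1` B) =
  (P (X @^-1` A) * P ((fun w => (W u w - W s w)%R b 0%R) @^-1` B))%E.
Proof.
move=> s0 su u1 mX A B mA mB; have s01 : 0 <= s <= 1 by lra.
rewrite (incr_law _ _ su)//; last exact: mX.
congr (_ * _)%E; have FT : F s setT.
  have [F0 FC _] := sF s01; rewrite -[setT](setD0 setT); exact: FC.
by have := incr_law b s0 su u1 FT mB; rewrite setTI probability_setT mul1e.
Qed.

(** In this lemma and the next the case s = u has to be allowed, since the nodes
    of a simple process may repeat; the increment is then zero. *)
Lemma incr_mean s u b X : 0 <= s -> s <= u -> u <= 1 -> measurable_wrt (F s) X -> intble P X ->
  \int[P]_w (X w * (W u w - W s w) b 0) = 0.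
Proof.
move=> s0; rewrite le_eqVlt => /orP[/eqP <- _ _ _|su u1 mX iX].
  under eq_Rintegral do rewrite subrr mxE mulr0.
  exact: Rint_cst.
have s01 : 0 <= s <= 1 by lra.
have [sY mY _] := incr_gauss b s0 su u1.
have [_ ->] := @indep_mul _ _ _ P _ R X (fun w => (W u w - W s w) b 0) id id
  (wrt_measurable s01 mX) sY.1 (incr_indep b s0 su u1 mX)
  (@measurable_id _ _ _) (@measurable_id _ _ _) iX (sqintble_intble sY).
by rewrite mY mulr0.
Qed.

Lemma incr_sq s u b X : 0 <= s -> s <= u -> u <= 1 -> measurable_wrt (F s) X -> sqintble P X ->
  sqintble P (fun w => X w * (W u w - W s w) b 0) /\
  moment2 P (fun w => X w * (W u w - W s w) b 0) = (u - s) * moment2 P X.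
Proof.
move=> s0; rewrite le_eqVlt => /orP[/eqP <- _ _ _|su u1 mX sX].
  rewrite (_ : (fun w => _) = fun=> 0); last by apply/funext => w; rewrite subrr mxE mulr0.
  rewrite subrr mul0r; split; first exact: sqintble_cst.
  by rewrite /moment2; under eq_Rintegral do rewrite expr0n/=; exact: Rint_cst.
have s01 : 0 <= s <= 1 by lra.
have [sY mY qY] := incr_gauss b s0 su u1.
have [iXY eXY] : intble P (fun w => X w ^+ 2 * (W u w - W s w) b 0 ^+ 2) /\
   \int[P]_w (X w ^+ 2 * (W u w - W s w) b 0 ^+ 2) =
   moment2 P X * moment2 P (fun w => (W u w - W s w) b 0).
  apply: (@indep_mul _ _ _ P _ R X (fun w => (W u w - W s w) b 0)
    (fun x => x ^+ 2) (fun x => x ^+ 2) (wrt_measurable s01 mX) sY.1).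
  - exact: incr_indep.
  - exact: exprn_measurable.
  - exact: exprn_measurable.
  - by case: sX.
  - by case: sY.
split.
  split; first by apply: measurable_funM; [case: sX|case: sY].
  by under eq_fun do rewrite exprMn.
rewrite {1}/moment2; under eq_Rintegral do rewrite exprMn.
by rewrite eXY qY mulrC.
Qed.

(** W u is the sum of a normal increment and of W 0, which vanishes almost
    surely. *)
Lemma wiener_sqintble u b : 0 <= u <= 1 -> sqintble P (fun w => W u w b 0).
Proof.
move=> /andP[u0 u1].
have s0 : sqintble P (fun w => W 0 w b 0).
  have m0 : measurable_fun [set: T] (fun w => W 0 w b 0).
    by apply: (@wrt_measurable 0); [rewrite lexx ler01|apply: wiener_wrt; rewrite lexx ler01].
  apply: expect_sq_sqintble => //; rewrite unlock.
  rewrite (@ae_eq_integral _ _ _ P setT (cst 0%E))//.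
  - by rewrite integral0.
  - by apply/measurable_EFinP; exact: measurable_funX.
  - have [_ H _ _] := hW; move: H; apply: filterS => w H _ /=.
    by rewrite H mxE expr0n.
move: u0; rewrite le_eqVlt => /orP[/eqP <-//|u0].
have [sI _ _] := incr_gauss b (lexx 0) u0 u1.
rewrite (_ : (fun w => _) = fun w => (W u w - W 0 w) b 0 + W 0 w b 0); first exact: sqintbleD.
by apply/funext => w; rewrite !mxE subrK.
Qed.

(** Each summand is an increment times a factor known at its left end; given the
    past its mean is zero, so it is orthogonal to the sum of the earlier ones. *)
Lemma ito_isometry (b : 'I_n) (m : nat) (s : nat -> R) (G : nat -> T -> R) :
  (forall j, (j <= m)%N -> 0 <= s j <= 1) ->
  (forall j, (j < m)%N -> s j <= s j.+1) ->
  (forall j, (j < m)%N -> measurable_wrt (F (s j)) (G j)) ->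
  (forall j, (j < m)%N -> sqintble P (G j)) ->
  [/\ sqintble P (fun w => \sum_(j < m) G j w * (W (s j.+1) w - W (s j) w) b 0),
    measurable_wrt (F (s m)) (fun w => \sum_(j < m) G j w * (W (s j.+1) w - W (s j) w) b 0)
  & moment2 P (fun w => \sum_(j < m) G j w * (W (s j.+1) w - W (s j) w) b 0) =
    \sum_(j < m) (s j.+1 - s j) * moment2 P (G j)].
Proof.
elim: m => [|m IH] H1 H2 H3 H4.
  have -> : (fun w => \sum_(j < 0) G j w * (W (s j.+1) w - W (s j) w) b 0) = fun=> 0.
    by apply/funext => w; rewrite big_ord0.
  split; [exact: sqintble_cst|apply: wrt_cst; exact: H1|].
  by rewrite big_ord0 /moment2; under eq_Rintegral do rewrite expr0n/=; exact: Rint_cst.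
have [sM mM qM] : [/\ sqintble P (fun w => \sum_(j < m) G j w * (W (s j.+1) w - W (s j) w) b 0),
    measurable_wrt (F (s m)) (fun w => \sum_(j < m) G j w * (W (s j.+1) w - W (s j) w) b 0)
  & moment2 P (fun w => \sum_(j < m) G j w * (W (s j.+1) w - W (s j) w) b 0) =
    \sum_(j < m) (s j.+1 - s j) * moment2 P (G j)].
  by apply: IH => j jm; [apply: H1|apply: H2|apply: H3|apply: H4]; exact: leqW.
have /andP[s0 s1] := H1 m (leqW (leqnn m)); have /andP[t0 t1] := H1 _ (leqnn m.+1).
have st := H2 m (leqnn _); have mG := H3 m (leqnn _); have sG := H4 m (leqnn _).
have [sI qI] := incr_sq b s0 st t1 mG sG.
set M := (fun w => \sum_(j < m) _) in sM mM qM.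
rewrite (_ : (fun w => \sum_(j < m.+1) _) = fun w => M w + G m w * (W (s m.+1) w - W (s m) w) b 0); last first.
  by apply/funext => w; rewrite big_ord_recr.
split.
- exact: sqintbleD.
- apply: wrtD; [by rewrite t0 t1|by apply: wrt_le mM|].
  by apply: wrtM; [by rewrite t0 t1|by apply: wrt_le mG|exact: incr_wrt].
- rewrite big_ord_recr/= -qM -qI /moment2 Rint_sqD//.
  suff -> : \int[P]_w (M w * (G m w * (W (s m.+1) w - W (s m) w) b 0)) = 0 by rewrite mulr0 addr0.
  under eq_Rintegral do rewrite mulrA.
  apply: (@incr_mean _ _ b (fun w => M w * G m w)) => //.
    by apply: wrtM => //; rewrite s0 s1.
  exact: sqintble_mul.
Qed.

End WienerIncr.

(** * Indicators of time intervals *)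

Section Indicators.
Context {R : realType}.
Local Notation mu := (@lebesgue_measure R).
Variables (t : R).
Implicit Types a b : R.

Definition itv_ind a b u : R := (a < u <= b)%R%:R.

Lemma itv_indE a b u : itv_ind a b u = \1_`]a, b] u.
Proof. by rewrite /itv_ind indicE; congr (nat_of_bool _)%:R; apply/idP/idP; rewrite inE/= in_itv. Qed.

Lemma integrable_ind a b (g : R -> R) : continuous g ->
  mu.-integrable `[0, t] (EFin \o (fun u => itv_ind a b u * g u)).
Proof.
move=> cg; apply: (@le_integrable _ _ _ mu _ _ _ (EFin \o g)) => //=.
- apply/measurable_EFinP; apply: measurable_funM.
    rewrite (_ : itv_ind a b = \1_`]a, b]); last by apply/funext => u; rewrite itv_indE.
    by apply: measurable_funTS; exact: measurable_indic.
  by apply: measurable_funTS; exact: continuous_measurable_fun.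
- move=> u _; rewrite lee_fin normrM ler_piMl// /itv_ind.
  by case: (_ < _ <= _); rewrite ?normr1 ?normr0.
- exact: integrable_cont.
Qed.

Lemma Rint_ind a b (g : R -> R) : continuous g -> 0 <= a -> a <= b -> b <= t ->
  \int[mu]_(u in `[0, t]) (itv_ind a b u * g u) = \int[mu]_(u in `[a, b]) g u.
Proof.
move=> cg a0 ab bt; rewrite -(@Rintegral_itv_obnd_cbnd _ a (BRight b)); last first.
  by apply: integrableS (integrable_cont a b cg) => //; exact: subset_itv_oc_cc.
have E : `]a, b]%classic = `[0, t]%classic `&` `]a, b]%classic :> set R.
  apply/seteqP; split=> [u|u []//]; rewrite /= !in_itv/= => /andP[au ub].
  by split; apply/andP; split; lra.
rewrite E Rintegral_mkcondr; apply: eq_Rintegral => u _.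
rewrite patchE; case: ifPn; rewrite itv_indE indicE => h.
  by rewrite h mul1r.
by rewrite (negbTE h) mul0r.
Qed.
End Indicators.

(** * Simple processes and their mean-square distance to a deterministic integrand *)

Section Simple.
Context {d : measure_display} {T : measurableType d} {R : realType}.
Variables (P : probability T R) (n : nat) (F : R -> set (set T)).
Hypotheses (hF : filtration F).
Variables (t : R) (H : simple_process F n t).
Hypothesis ht : 0 <= t <= 1.
Local Notation N := (sp_size H).
Local Notation s := (sp_time H).
Local Notation mu := (@lebesgue_measure R).

Lemma sp_time_mono i j : (i <= j)%N -> (j <= N)%N -> s i <= s j.
Proof.
move=> ij; rewrite -(subnKC ij); elim: (j - i)%N => [|k IH]; first by rewrite addn0.
rewrite addnS => h; apply: (le_trans (IH (ltnW h))); exact: sp_time_le.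
Qed.

Lemma sp_time_itv j : (j <= N)%N -> 0 <= s j <= t.
Proof.
move=> jN; have h0 := sp_time_mono (leq0n j) jN; have h1 := sp_time_mono jN (leqnn N).
by move: h0 h1; rewrite (sp_time0 H) (sp_timeN H) => -> ->.
Qed.

Lemma sp_time_01 j : (j <= N)%N -> 0 <= s j <= 1.
Proof.
move=> /sp_time_itv /andP[-> h]; have /andP[_ t1] := ht.
exact: le_trans t1.
Qed.

Definition sp_mean j a b : R := \int[P]_w sp_coef H j w a b.
Definition sp_dev j a b w : R := sp_coef H j w a b - sp_mean j a b.

Lemma sp_coef_sqintble j a b : (j < N)%N -> sqintble P (fun w => sp_coef H j w a b).
Proof.
move=> jN; have [M HM] := sp_bounded H.
apply: (@sqintble_bounded _ _ _ P _ M); last by move=> w; exact: HM.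
apply: (wrt_measurable hF (sp_time_01 (ltnW jN))); exact: sp_adapted.
Qed.

Lemma sp_dev_sqintble j a b : (j < N)%N -> sqintble P (sp_dev j a b).
Proof. by move=> jN; apply: sqintbleB; [exact: sp_coef_sqintble|exact: sqintble_cst]. Qed.

Lemma sp_dev_mean j a b : (j < N)%N -> \int[P]_w sp_dev j a b w = 0.
Proof.
move=> jN; rewrite RintegralB//; [|exact/sqintble_intble/sp_coef_sqintble|exact: intble_cst].
by rewrite Rint_cst subrr.
Qed.

Lemma sp_dev_adapted j a b : (j < N)%N -> measurable_wrt (F (s j)) (sp_dev j a b).
Proof.
move=> jN; apply: (wrtD hF) => //; [exact: sp_time_01 (ltnW jN)|exact: sp_adapted|].
by apply: (wrt_cst hF); exact: sp_time_01 (ltnW jN).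
Qed.

Local Notation indj j := (itv_ind (s j) (s j.+1)).

(** The intervals between consecutive nodes are disjoint, so at most one
    coefficient is active at a given time. *)
Lemma itv_ind_orth (j l : 'I_N) u : j != l -> indj j u * indj l u = 0.
Proof.
wlog jl : j l / (j < l)%N.
  move=> W jl; case: (ltngtP j l) => h; first exact: W.
    by rewrite mulrC; apply: W => //; rewrite eq_sym.
  by move/val_inj: h jl => ->; rewrite eqxx.
move=> _; rewrite /itv_ind; case: andP => [[_ h1]|]; last by rewrite mul0r.
case: andP => [[h2 _]|]; last by rewrite mulr0.
have : s j.+1 <= s l by apply: sp_time_mono => //; exact: ltnW.
lra.
Qed.

Lemma itv_ind_sum_sqr (f : 'I_N -> R) u :
  (\sum_(j < N) indj j u * f j) ^+ 2 = \sum_(j < N) indj j u * f j ^+ 2.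
Proof.
rewrite expr2 mulr_suml; apply: eq_bigr => j _; rewrite mulr_sumr (bigD1 j)//= big1.
  rewrite addr0 /itv_ind; case: (_ < _ <= _); rewrite ?mul1r ?mul0r//.
by move=> l lj; rewrite mulrACA itv_ind_orth ?mul0r// eq_sym.
Qed.

Lemma sp_evalE u w a b : sp_eval H u w a b = \sum_(j < N) indj j u * sp_coef H j w a b.
Proof.
rewrite /sp_eval summxE big_mkcond/=; apply: eq_bigr => j _.
by rewrite /itv_ind; case: (_ < _ <= _); rewrite ?mul1r ?mul0r.
Qed.

(** The bias-variance decomposition at a fixed time u.  It is an equality, so the
    error of a simple process controls both its fluctuation around its mean
    ([sp_dev_le]) and the distance from its mean to h ([sp_coef_le]). *)
Lemma expect_sp_eval u (h : 'M[R]_n) :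
  ('E_P[fun w => (frobenius_norm (sp_eval H u w - h) ^+ 2)%R] =
   (\sum_a \sum_b (\sum_(j < N) indj j u * moment2 P (sp_dev j a b) +
      (\sum_(j < N) indj j u * sp_mean j a b - h a b) ^+ 2))%:E)%E.
Proof.
have sC a b : sqintble P (fun w => \sum_(j < N) indj j u * sp_dev j a b w).
  by apply: sqintble_sum => j; apply: sqintbleZ; exact: sp_dev_sqintble.
pose m a b := \sum_(j < N) indj j u * sp_mean j a b - h a b.
have sm a b : sqintble P (fun=> m a b) by exact: sqintble_cst.
have sS a b : intble P (fun w => (\sum_(j < N) indj j u * sp_dev j a b w + m a b) ^+ 2).
  by have [] := sqintbleD (sC a b) (sm a b).
transitivity ('E_P[fun w => (\sum_a \sum_b (\sum_(j < N) indj j u * sp_dev j a b w + m a b) ^+ 2)%R])%E.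
  congr ('E_P[_])%E; apply/funext => w; rewrite /frobenius_norm sqr_sqrtr; last first.
    by apply: sumr_ge0 => a _; apply: sumr_ge0 => b _; exact: sqr_ge0.
  apply: eq_bigr => a _; apply: eq_bigr => b _; rewrite !mxE sp_evalE /m; congr (_ ^+ 2).
  rewrite addrA -big_split/=; congr (_ - _); apply: eq_bigr => j _.
  by rewrite /sp_dev; ring.
rewrite expectE; last by apply: intble_sum => a; exact: intble_sum.
congr (_%:E); rewrite Rint_sum => [|a]; last exact: intble_sum.
apply: eq_bigr => a _; rewrite Rint_sum//; apply: eq_bigr => b _.
rewrite Rint_sqD// Rint_cst RintegralZr//; last exact: sqintble_intble.
rewrite [X in 2 * (X * _)]Rint_sum; last first.
  by move=> j; apply: intbleZ; apply: sqintble_intble; exact: sp_dev_sqintble.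
rewrite [X in 2 * (X * _)]big1 ?mul0r ?mulr0 ?addr0; last first.
  move=> j _; rewrite RintegralZl//; last by apply: sqintble_intble; exact: sp_dev_sqintble.
  by rewrite sp_dev_mean ?mulr0.
congr (_ + _); under eq_Rintegral do rewrite itv_ind_sum_sqr.
rewrite Rint_sum; last first.
  by move=> j; apply: intbleZ; have [] := @sp_dev_sqintble j a b (ltn_ord j).
by apply: eq_bigr => j _; rewrite RintegralZl//; have [] := @sp_dev_sqintble j a b (ltn_ord j).
Qed.

Section Time.
Variable h : R -> 'M[R]_n.
Hypothesis ch : forall a b, continuous (fun u => h u a b).

Local Notation tintble f := (mu.-integrable `[0, t] (EFin \o f)).

Let mI : @measurable _ (measurableTypeR R) `[0, t].
Proof. exact: measurable_itv. Qed.

Lemma tintbleD f g : tintble f -> tintble g -> tintble (fun u => f u + g u).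
Proof. by move=> i1 i2; have := integrableD mI i1 i2. Qed.

Let V a b u := \sum_(j < N) indj j u * moment2 P (sp_dev j a b).
Let S a b u := \sum_(j < N) indj j u * sp_mean j a b.
Let Q a b u := (S a b u - h u a b) ^+ 2.

Let iV a b : tintble (V a b).
Proof. by apply: (integrable_sumr _ mI) => j; apply: integrable_ind => x; exact: cvg_cst. Qed.

Let iQ a b : tintble (Q a b).
Proof.
rewrite (_ : Q a b = fun u => \sum_(j < N) indj j u * (sp_mean j a b ^+ 2 - 2 * sp_mean j a b * h u a b)
   + h u a b * h u a b).
  apply: tintbleD.
    apply: (integrable_sumr _ mI) => j; apply: integrable_ind => x; apply: cvgB; first exact: cvg_cst.
    by apply: cvgM; [exact: cvg_cst|exact: ch].
  by apply: integrable_cont => x; apply: cvgM; exact: ch.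
apply/funext => u; rewrite /Q sqrrB /S itv_ind_sum_sqr.
rewrite [in RHS](eq_bigr (fun j : 'I_N => indj j u * sp_mean j a b ^+ 2 -
   2 * (indj j u * sp_mean j a b) * h u a b)); last by move=> j _; ring.
by rewrite sumrB -mulr_suml -mulr_sumr mulr2n; ring.
Qed.

Let V0 a b u : 0 <= V a b u.
Proof. by apply: sumr_ge0 => j _; rewrite mulr_ge0 ?moment2_ge0// /itv_ind; case: (_ < _ <= _). Qed.

Let Q0 a b u : 0 <= Q a b u. Proof. exact: sqr_ge0. Qed.

(** The mean-square distance from H to h in L^2([0, t] x Omega), as a real number
    (see [sp_errE]). *)
Definition sp_err : R := \int[mu]_(u in `[0, t]) (\sum_a \sum_b (V a b u + Q a b u)).

Let iVQ a b : tintble (fun u => V a b u + Q a b u).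
Proof. exact: tintbleD. Qed.

Let iS1 a : tintble (fun u => \sum_b (V a b u + Q a b u)).
Proof. by apply: (integrable_sumr _ mI). Qed.

Let iS2 : tintble (fun u => \sum_a \sum_b (V a b u + Q a b u)).
Proof. by apply: (integrable_sumr _ mI). Qed.

Lemma sp_errE :
  (\int[mu]_(u in `[0%R, t]) 'E_P[fun w => (frobenius_norm (sp_eval H u w - h u) ^+ 2)%R] =
   sp_err%:E)%E.
Proof.
under eq_integral do rewrite expect_sp_eval.
by rewrite /sp_err /Rintegral fineK//; apply: integrable_fin_num.
Qed.

Let VQ_le a b u : V a b u + Q a b u <= \sum_a \sum_b (V a b u + Q a b u).
Proof.
have h0 a' b' : 0 <= V a' b' u + Q a' b' u by rewrite addr_ge0.
rewrite (bigD1 a)//= (bigD1 b)//=.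
rewrite -addrA lerDl addr_ge0// sumr_ge0// => i _; last by apply: sumr_ge0.
Qed.

Lemma sp_dev_le a b : \sum_(j < N) (s j.+1 - s j) * moment2 P (sp_dev j a b) <= sp_err.
Proof.
apply: (@le_trans _ _ (\int[mu]_(u in `[0, t]) V a b u)); last first.
  apply: le_Rintegral => // u _; apply: le_trans (VQ_le a b u).
  by rewrite lerDl.
rewrite le_eqVlt; apply/orP; left; apply/eqP; rewrite (Rintegral_sumr _ mI); last first.
  by move=> j; apply: integrable_ind => x; exact: cvg_cst.
apply: eq_bigr => j _.
have /andP[s0 _] := sp_time_itv (ltnW (ltn_ord j)).
have /andP[_ s1] := sp_time_itv (ltn_ord j).
have ss : s j <= s j.+1 by exact: sp_time_le.
rewrite (@Rint_ind _ t _ _ (fun=> moment2 P (sp_dev j a b)))//; last by move=> x; exact: cvg_cst.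
rewrite Rintegral_cst//= lebesgue_measure_itv/= lte_fin; case: ltP => h1.
  by rewrite -EFinB/= mulrC.
have -> : s j.+1 = s j by apply/eqP; rewrite eq_le ss h1.
by rewrite subrr mul0r /= mulr0.
Qed.

(** The left-hand side is the integral over [0, t] of (S - h) cos(l u), S being
    the mean of the process.  Young's inequality |v| <= e + v^2/e replaces Cauchy-Schwarz. *)
Lemma sp_coef_le a b l e : 0 < e -> 0 < l ->
  `|\sum_(j < N) sp_mean j a b * ((sin (l * s j.+1) - sin (l * s j)) / l) -
    \int[mu]_(u in `[0, t]) (h u a b * cos (l * u))| <= e + sp_err / e.
Proof.
move=> e0 l0.
have cc : continuous (fun u : R => cos (l * u)).
  move=> x; apply: (@continuous_comp _ _ _ (fun u => l * u) cos); last exact: continuous_cos.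
  by apply: cvgM; [exact: cvg_cst|exact: cvg_id].
have iC j : tintble (fun u => indj j u * (sp_mean j a b * cos (l * u))).
  by apply: integrable_ind => x; apply: cvgM; [exact: cvg_cst|exact: cc].
have E : \sum_(j < N) sp_mean j a b * ((sin (l * s j.+1) - sin (l * s j)) / l) =
   \int[mu]_(u in `[0, t]) (\sum_(j < N) indj j u * (sp_mean j a b * cos (l * u))).
  rewrite (Rintegral_sumr _ mI)//; apply: eq_bigr => j _.
  have /andP[s0 _] := sp_time_itv (ltnW (ltn_ord j)).
  have /andP[_ s1] := sp_time_itv (ltn_ord j).
  have ss : s j <= s j.+1 by exact: sp_time_le.
  rewrite (@Rint_ind _ t _ _ (fun u => sp_mean j a b * cos (l * u)))//; last first.
    by move=> x; apply: cvgM; [exact: cvg_cst|exact: cc].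
  rewrite RintegralZl//; last exact: integrable_cont.
  have dF (x : R) : is_derive x (1 : R) (fun u => l^-1 * sin (l * u)) (cos (l * x)).
    have d2 : is_derive x (1 : R) (fun u : R => l * u) l.
      by apply: is_derive_eq; rewrite /GRing.scale/=; ring.
    have d4 := @is_derive1_comp _ sin _ _ _ _ (is_derive_sin _) d2.
    by apply: is_derive_eq; rewrite /GRing.scale/=; field; rewrite gt_eqF.
  by rewrite /Rintegral (integral_FTC ss cc dF)/=; congr (_ * _); ring.
have iS : tintble (fun u => \sum_(j < N) indj j u * (sp_mean j a b * cos (l * u))).
  by apply: (integrable_sumr _ mI).
have iH : tintble (fun u => h u a b * cos (l * u)).
  by apply: integrable_cont => x; apply: cvgM; [exact: ch|exact: cc].
rewrite E -(RintegralB mI iS iH).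
have iD := integrableB mI iS iH.
apply: (le_trans (le_normr_Rintegral mI iD)).
have iE : tintble (fun u => e^-1 * Q a b u).
  by have := integrableZl mI e^-1 (iQ a b).
have ie : tintble (fun=> e) by apply: integrable_cont => x; exact: cvg_cst.
apply: (@le_trans _ _ (\int[mu]_(u in `[0, t]) (e + e^-1 * Q a b u))).
  apply: le_Rintegral => //; first by have := integrable_norm iD.
    exact: tintbleD.
  move=> u _.
  rewrite (_ : _ - _ = (S a b u - h u a b) * cos (l * u)); last first.
    by rewrite mulrBl /S mulr_suml; congr (_ - _); apply: eq_bigr => j _; rewrite mulrA.
  rewrite normrM /Q; apply: (@le_trans _ _ `|S a b u - h u a b|).
    by rewrite ler_piMr// cos_max.
  rewrite -[(S a b u - h u a b) ^+ 2]real_normK ?num_real//.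
  move: `|_| => v; have := sqr_ge0 (v - e) => h1; have := sqr_ge0 v => h2.
  rewrite -(ler_pM2l e0) mulrDr mulrA divff ?gt_eqF// mul1r; nra.
rewrite (RintegralD mI ie iE) RintegralZl// Rintegral_cst//=.
apply: lerD.
  rewrite lebesgue_measure_itv/= lte_fin; case: ifP => _ /=; last by rewrite mulr0 ltW.
  by rewrite oppr0 addr0 ler_piMr ?(ltW e0)//; have /andP[] := ht.
rewrite mulrC ler_wpM2r ?invr_ge0 ?(ltW e0)//.
apply: le_Rintegral => // u _; apply: le_trans (VQ_le a b u).
by rewrite lerDr.
Qed.

End Time.
End Simple.

(** * Integrals of deterministic step functions *)

Section Vec.
Context {d : measure_display} {T : measurableType d} {R : realType}.
Variables (P : probability T R) (n : nat).

Lemma enorm_sqE (x : 'cV[R]_n) : enorm x ^+ 2 = \sum_a x a 0 ^+ 2.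
Proof. by rewrite /enorm sqr_sqrtr// sumr_ge0// => i _; exact: sqr_ge0. Qed.

Lemma expect_enorm (V : T -> 'cV[R]_n) : (forall a, sqintble P (fun w => V w a 0)) ->
  ('E_P[fun w => (enorm (V w) ^+ 2)%R] = (\sum_a moment2 P (fun w => V w a 0))%:E)%E.
Proof.
move=> sV; rewrite (_ : (fun w => _) = fun w => \sum_a V w a 0 ^+ 2); last first.
  by apply/funext => w; rewrite enorm_sqE.
have iV a : intble P (fun w => V w a 0 ^+ 2) by have [] := sV a.
by rewrite expectE ?Rint_sum//; exact: intble_sum.
Qed.

Lemma cvg_enorm (V : nat -> T -> 'cV[R]_n) :
  (forall N a, sqintble P (fun w => V N w a 0)) ->
  ('E_P[fun w => (enorm (V N w) ^+ 2)%R] @[N --> \oo] --> 0)%E ->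
  forall a, moment2 P (fun w => V N w a 0) @[N --> \oo] --> (0 : R).
Proof.
move=> sV H a.
have {}H : \sum_b moment2 P (fun w => V N w b 0) @[N --> \oo] --> (0 : R).
  have H' : EFin (\sum_b moment2 P (fun w => V N w b 0)) @[N --> \oo] --> EFin 0.
    rewrite (_ : (fun N => _) = fun N => 'E_P[fun w => (enorm (V N w) ^+ 2)%R]%E)//.
    by apply/funext => N; rewrite expect_enorm.
  exact: (fine_cvg H').
apply: (squeeze_cvgr _ (cvg_cst (0 : R)) H); apply: nearW => N.
by rewrite moment2_ge0/= (bigD1 a)//= lerDl sumr_ge0// => i _; exact: moment2_ge0.
Qed.

Lemma sqintble_enorm (V : T -> 'cV[R]_n) : (forall a, measurable_fun [set: T] (fun w => V w a 0)) ->
  ('E_P[fun w => (enorm (V w) ^+ 2)%R] < +oo)%E -> forall a, sqintble P (fun w => V w a 0).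
Proof.
move=> mV fV a; apply: expect_sq_sqintble => //; apply: le_lt_trans fV.
rewrite unlock; apply: ge0_le_integral => //=.
- by move=> w _; rewrite lee_fin sqr_ge0.
- by apply/measurable_EFinP; exact: measurable_funX.
- apply/measurable_EFinP; rewrite (_ : (fun w => _) = fun w => \sum_a V w a 0 ^+ 2).
    by apply: measurable_sum => i; exact: measurable_funX.
  by apply/funext => w; rewrite enorm_sqE.
- move=> w _; rewrite lee_fin enorm_sqE (bigD1 a)//= lerDl sumr_ge0// => i _.
  exact: sqr_ge0.
Qed.

End Vec.

Section Main.
Context {d : measure_display} {T : measurableType d} {R : realType}.
Variables (P : probability T R) (n : nat) (F : R -> set (set T))
    (W : R -> T -> 'cV[R]_n) (Z : nat -> T -> 'cV[R]_n).
Hypotheses (hF : filtration F) (hW : wiener_process P F W)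
    (hZ : iid_standard_normal P Z) (hWZ : karhunen_loeve P W Z).

Let Zt k b (w : T) : R := Z k.+1 w b 0.
Let sZ k b : sqintble P (Zt k b). Proof. by have [] := iid_gauss hZ k b. Qed.
Let zZ k b : \int[P]_w Zt k b w = 0. Proof. by have [] := iid_gauss hZ k b. Qed.
Let oZ k b l c : \int[P]_w (Zt k b w * Zt l c w) = ((k == l) && (b == c))%:R.
Proof. exact: iid_orthonormal. Qed.

Let kl_err u b K w : R := W u w b 0 -
  Num.sqrt 2 * \sum_(k < K) (sin (freq k.+1 * u) / freq k.+1) * Zt k b w.

Let sqintble_kl_err u b K : 0 <= u <= 1 -> sqintble P (kl_err u b K).
Proof.
move=> u01; apply: sqintbleB; first exact: (wiener_sqintble hF hW).
by apply: sqintbleZ; apply: sqintble_sum => k; exact: sqintbleZ.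
Qed.

Let kl_cvg u b : 0 <= u <= 1 -> moment2 P (kl_err u b K) @[K --> \oo] --> (0 : R).
Proof.
move=> u01; pose V K w := W u w - Num.sqrt 2 *:
        \sum_(1 <= k < K.+1) (sin (freq k * u) / freq k) *: Z k w.
have VE b' K w : V K w b' 0 = kl_err u b' K w.
  rewrite /V /kl_err !mxE summxE big_add1/= big_mkord; congr (_ - _ * _).
  by apply: eq_bigr => k _; rewrite mxE.
have sV K b' : sqintble P (fun w => V K w b' 0).
  by rewrite (_ : (fun w => _) = kl_err u b' K); [exact: sqintble_kl_err|apply/funext => w; rewrite VE].
have := cvg_enorm sV (hWZ u01) b.
rewrite (_ : (fun N => _) = fun K => moment2 P (kl_err u b K))//.
by apply/funext => K; apply: eq_moment2 => w; rewrite VE.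
Qed.

Variables (t : R).
Hypothesis t01 : 0 <= t <= 1.

Section Step.
Variable S : simple_process F n t.
Local Notation N := (sp_size S).
Local Notation s := (sp_time S).
Variable a : 'I_n.

(** Component a of the integral of the deterministic step function whose values
    are the means of the coefficients of S. *)
Definition step_int w : R :=
  \sum_b \sum_(j < N) sp_mean P S j a b * (W (s j.+1) w - W (s j) w) b 0.

(** sqrt 2 times the integral of that step function against cos(lambda_k u), the
    index k standing for the frequency of number k + 1. *)
Definition step_coef k b : R := Num.sqrt 2 *
  \sum_(j < N) sp_mean P S j a b * ((sin (freq k.+1 * s j.+1) - sin (freq k.+1 * s j)) / freq k.+1).

Let s01 j : (j <= N)%N -> 0 <= s j <= 1.
Proof. exact: sp_time_01. Qed.

Let sqintble_incr j b : (j < N)%N -> sqintble P (fun w => (W (s j.+1) w - W (s j) w) b 0).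
Proof.
move=> jN; rewrite (_ : (fun w => _) = fun w => W (s j.+1) w b 0 - W (s j) w b 0).
  by apply: sqintbleB; apply: (wiener_sqintble hF hW); apply: s01 => //; exact: ltnW.
by apply/funext => w; rewrite !mxE.
Qed.

Lemma sqintble_step_int : sqintble P step_int.
Proof.
apply: sqintble_sum => b; apply: sqintble_sum => j; apply: sqintbleZ.
exact: sqintble_incr.
Qed.

(** The integral is a finite linear combination of values of W, so the
    Karhunen-Loeve error of each of them carries over. *)
Lemma step_int_chaos :
  moment2 P (fun w => step_int w - chaos Zt step_coef K w) @[K --> \oo] --> (0 : R).
Proof.
pose E b (j : 'I_N) K w := sp_mean P S j a b * (kl_err (s j.+1) b K w - kl_err (s j) b K w).
have sE b j K : sqintble P (E b j K).
  by apply: sqintbleZ; apply: sqintbleB; apply: sqintble_kl_err; apply: s01 => //; exact: ltnW.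
have cE b j : moment2 P (E b j K) @[K --> \oo] --> (0 : R).
  have h1 : 0 <= s j.+1 <= 1 by exact: s01.
  have h0 : 0 <= s j <= 1 by apply: s01; exact: ltnW.
  apply: (@squeeze_cvgr _ _ _ _ (fun=> 0) (fun K => sp_mean P S j a b ^+ 2 *
    (2 * (moment2 P (kl_err (s j.+1) b K) + moment2 P (kl_err (s j) b K))))).
  - apply: nearW => K; rewrite moment2_ge0/= moment2Z; last by apply: sqintbleB; exact: sqintble_kl_err.
    rewrite ler_wpM2l ?sqr_ge0//.
    have := moment2_le2 (sqintble_kl_err b K h1) (sqintbleZ (-1) (sqintble_kl_err b K h0)).
    rewrite moment2Z ?sqrrN ?expr1n ?mul1r; last exact: sqintble_kl_err.
    apply: le_trans; rewrite le_eqVlt; apply/orP; left; apply/eqP; apply: eq_moment2 => w.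
    by rewrite mulN1r.
  - exact: cvg_cst.
  - rewrite [X in _ --> X](_ : _ = sp_mean P S j a b ^+ 2 * (2 * (0 + 0))); last by rewrite addr0 !mulr0.
    by apply: cvgM; [exact: cvg_cst|apply: cvgM; [exact: cvg_cst|apply: cvgD; exact: kl_cvg]].
have := @moment2_sum_cvg0 _ _ _ P _ (index_enum 'I_n) (fun b K w => \sum_(j < N) E b j K w)
  (fun b K => sqintble_sum _ (fun j => sE b j K))
  (fun b => moment2_sum_cvg0 (index_enum 'I_N) (sE b) (cE b)).
rewrite (_ : (fun N => _) = fun K => moment2 P (fun w => step_int w - chaos Zt step_coef K w))//.
apply/funext => K; apply: eq_moment2 => w.
rewrite /step_int /chaos [X in _ - X]exchange_big/= -sumrB; apply: eq_bigr => b _.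
transitivity (\sum_(j < N) (sp_mean P S j a b * (W (s j.+1) w - W (s j) w) b 0 -
   \sum_(k < K) Num.sqrt 2 * (sp_mean P S j a b *
     ((sin (freq k.+1 * s j.+1) - sin (freq k.+1 * s j)) / freq k.+1)) * Zt k b w)).
  apply: eq_bigr => j _; rewrite /E /kl_err !mxE.
  set A1 := \sum_(k < K) _; set A0 := \sum_(k < K) _.
  rewrite (_ : \sum_(k < K) _ = Num.sqrt 2 * sp_mean P S j a b * (A1 - A0)); first by ring.
  rewrite /A1 /A0 -sumrB mulr_sumr; apply: eq_bigr => k _; ring.
rewrite sumrB; congr (_ - _); rewrite exchange_big/=; apply: eq_bigr => k _.
by rewrite /step_coef mulr_sumr mulr_suml.
Qed.

End Step.
End Main.

(** * Integrals of continuous deterministic integrands *)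

Section ItoChaos.
Context {d : measure_display} {T : measurableType d} {R : realType}.
Variables (P : probability T R) (n : nat) (F : R -> set (set T))
    (W : R -> T -> 'cV[R]_n) (Z : nat -> T -> 'cV[R]_n).
Hypotheses (hF : filtration F) (hW : wiener_process P F W)
    (hZ : iid_standard_normal P Z) (hWZ : karhunen_loeve P W Z).
Variables (t : R) (t01 : 0 <= t <= 1) (h : R -> 'M[R]_n) (J : T -> 'cV[R]_n).
Hypothesis ch : forall a b, continuous (fun u => h u a b).
Hypothesis hJ : is_ito_integral P F W t (fun u _ => h u) J.

Lemma sp_integralE (S : simple_process F n t) a w :
  sp_integral S W w a 0 = \sum_b \sum_(j < sp_size S)
    sp_coef S j w a b * (W (sp_time S j.+1) w - W (sp_time S j) w) b 0.
Proof.
rewrite /sp_integral summxE exchange_big/=; apply: eq_bigr => j _.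
by rewrite mxE.
Qed.

Lemma sqintble_sp_integral (S : simple_process F n t) a :
  sqintble P (fun w => sp_integral S W w a 0).
Proof.
rewrite (_ : (fun w => _) = fun w => \sum_b \sum_(j < sp_size S)
    sp_coef S j w a b * (W (sp_time S j.+1) w - W (sp_time S j) w) b 0); last first.
  by apply/funext => w; exact: sp_integralE.
apply: sqintble_sum => b.
have [//] := @ito_isometry _ _ _ P n F W hF hW b (sp_size S) (sp_time S) (fun j w => sp_coef S j w a b)
  (sp_time_01 t01) (@sp_time_le _ _ _ _ _ _ S) (fun j => @sp_adapted _ _ _ _ _ _ S j a b)
  (fun j => sp_coef_sqintble P hF t01 a b (j := j)).
Qed.

Lemma sp_integral_step_int (S : simple_process F n t) a w :
  sp_integral S W w a 0 - step_int P W S a w =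
  \sum_b \sum_(j < sp_size S) sp_dev P S j a b w * (W (sp_time S j.+1) w - W (sp_time S j) w) b 0.
Proof.
rewrite sp_integralE /step_int -sumrB; apply: eq_bigr => b _; rewrite -sumrB.
by apply: eq_bigr => j _; rewrite -mulrBl.
Qed.

(** The Ito isometry identifies this second moment with the variance part of the
    error of S. *)
Lemma moment2_dev_integral (S : simple_process F n t) a b :
  let f w := \sum_(j < sp_size S) sp_dev P S j a b w *
      (W (sp_time S j.+1) w - W (sp_time S j) w) b 0 in
  sqintble P f /\ moment2 P f <= sp_err P S h.
Proof.
have [sf _ qf] := @ito_isometry _ _ _ P n F W hF hW b (sp_size S) (sp_time S) (fun j => sp_dev P S j a b)
  (sp_time_01 t01) (@sp_time_le _ _ _ _ _ _ S) (fun j => sp_dev_adapted P hF t01 a b (j := j))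
  (fun j => sp_dev_sqintble P hF t01 a b (j := j)).
by split=> //=; rewrite qf; exact: sp_dev_le.
Qed.

(** The deterministic step functions obtained by averaging the simple processes
    have integrals that still converge to J (IU and IJ below), expansions by
    [step_int_chaos], and convergent coefficients by [sp_coef_le]; these are the
    hypotheses of [chaos_limit]. *)
Lemma ito_chaos a :
  sqintble P (fun w => J w a 0) /\
  moment2 P (fun w => J w a 0 - chaos (fun k b w => Z k.+1 w b 0) (fun k b => Num.sqrt 2 *
      \int[lebesgue_measure]_(u in `[0, t]) (h u a b * cos (freq k.+1 * u))) K w)
    @[K --> \oo] --> (0 : R).
Proof.
have [rJ [S [S1 S2]]] := hJ.
have err0 : sp_err P (S N) h @[N --> \oo] --> (0 : R).
  have H' : EFin (sp_err P (S N) h) @[N --> \oo] --> EFin 0.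
    have -> : (fun N => EFin (sp_err P (S N) h)) = fun N => 
       (\int[lebesgue_measure]_(u in `[0%R, t])
        'E_P[fun w => (frobenius_norm (sp_eval (S N) u w - h u) ^+ 2)%R])%E.
      by apply/funext => N; rewrite sp_errE.
    exact: S1.
  exact: (fine_cvg H').
pose I N w := sp_integral (S N) W w a 0.
have sI N : sqintble P (I N) by exact: sqintble_sp_integral.
have sJ b : sqintble P (fun w => J w b 0).
  have /fine_cvgP[[N0 _ /(_ N0 (leqnn _)) fN] _] := S2.
  have := @sqintble_enorm _ _ _ P n (fun w => sp_integral (S N0) W w - J w).
  move=> /(_ _ _ b) sD.
  rewrite (_ : (fun w => _) = fun w => sp_integral (S N0) W w b 0 -
     (sp_integral (S N0) W w - J w) b 0); last first.
    by apply/funext => w; rewrite !mxE opprB addrC subrK.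
  apply: sqintbleB; first exact: sqintble_sp_integral.
  apply: sD; last by rewrite ltey_eq fN.
  move=> i; rewrite (_ : (fun w => _) = fun w => sp_integral (S N0) W w i 0 - J w i 0); last first.
    by apply/funext => w; rewrite !mxE.
  by apply: measurable_funB; [have [] := @sqintble_sp_integral (S N0) i|exact: rJ].
split=> //.
have IJ : moment2 P (fun w => I N w - J w a 0) @[N --> \oo] --> (0 : R).
  have := @cvg_enorm _ _ _ P n (fun N w => sp_integral (S N) W w - J w).
  have E b N : (fun w => (sp_integral (S N) W w - J w) b 0) =
      fun w => sp_integral (S N) W w b 0 - J w b 0.
    by apply/funext => w; rewrite !mxE.
  move=> /(_ _ S2 a); rewrite (_ : (fun N => _) = fun N => moment2 P (fun w => I N w - J w a 0)); last first.
    by apply/funext => N; rewrite E.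
  by apply=> N b; rewrite E; apply: sqintbleB => //; exact: sqintble_sp_integral.
have IU : moment2 P (fun w => I N w - step_int P W (S N) a w) @[N --> \oo] --> (0 : R).
  pose D b N w := \sum_(j < sp_size (S N)) sp_dev P (S N) j a b w *
      (W (sp_time (S N) j.+1) w - W (sp_time (S N) j) w) b 0.
  have := @moment2_sum_cvg0 _ _ _ P _ (index_enum 'I_n) D.
  rewrite (_ : (fun N => _) = fun N => moment2 P (fun w => I N w - step_int P W (S N) a w)).
    apply=> [b N|b]; first by have [] := @moment2_dev_integral (S N) a b.
    apply: (squeeze_cvgr _ (cvg_cst (0 : R)) err0); apply: nearW => N.
    by rewrite moment2_ge0; have [] := @moment2_dev_integral (S N) a b.
  by apply/funext => N; apply: eq_moment2 => w; rewrite /I sp_integral_step_int.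
have sU N : sqintble P (step_int P W (S N) a) by exact: (sqintble_step_int hF hW t01).
apply: (@chaos_limit _ _ _ P n (fun k b w => Z k.+1 w b 0) _ _ (fun w => J w a 0)
    (fun N => step_int P W (S N) a) (fun N => step_coef P (S N) a)).
- by move=> k b; have [] := iid_gauss hZ k b.
- by move=> k b l c; exact: iid_orthonormal.
- exact: sJ.
- exact: sU.
- by move=> N; exact: (step_int_chaos hF hW hZ hWZ t01).
- apply: (@squeeze_cvgr _ _ _ _ (fun=> 0) (fun N => 2 * (moment2 P (fun w => I N w - J w a 0) +
    moment2 P (fun w => I N w - step_int P W (S N) a w)))).
  + apply: nearW => N; rewrite moment2_ge0/=.
    have s1 := sqintbleB (sI N) (sJ a); have s2 := sqintbleB (sI N) (sU N).
    have := moment2_le2 (sqintbleZ (-1) s1) s2; rewrite moment2Z// sqrrN expr1n mul1r.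
    apply: le_trans; rewrite le_eqVlt; apply/orP; left; apply/eqP; apply: eq_moment2 => w.
    by ring.
  + exact: cvg_cst.
  + rewrite [X in _ --> X](_ : _ = 2 * (0 + 0)); last by rewrite addr0 mulr0.
    by apply: cvgM; [exact: cvg_cst|exact: cvgD].
move=> k b; apply: cvgM; first exact: cvg_cst.
apply/cvgrPdist_le => /= e e0.
have e2 : 0 < e / 2 by rewrite divr_gt0.
have [N0 HN] := cvg0_ex err0 (mulr_gt0 e2 e2).
exists N0 => // N /= /HN {}HN; rewrite distrC.
apply: (le_trans (sp_coef_le P (S N) t01 ch a b e2 (freq_gt0 (ltn0Sn k)))).
have : sp_err P (S N) h / (e / 2) <= e / 2 by rewrite ler_pdivrMr.
lra.
Qed.

End ItoChaos.

(** * The error of the truncated expansion *)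

Section Deterministic.
Context {R : realType} {n : nat}.
Variables (L : 'M[R]_n) (hL : negative_semidefinite L) (B : 'M[R]_n) (t : R).

Lemma continuous_expm_entry a b : continuous (fun u => expm ((t - u) *: L) a b).
Proof.
have [p [Q [e [QQ QL _]]]] := real_spectral hL.
rewrite (_ : (fun u => _) = fun u => \sum_c expR ((t - u) * e c) * (Q c a * Q c b)); last first.
  by apply/funext => u; exact: expm_spectral.
move=> u; apply: cvg_sumr => c; apply: cvgM; last exact: cvg_cst.
apply: (@continuous_comp _ _ _ (fun u => (t - u) * e c) expR); last exact: continuous_expR.
by apply: cvgM; [apply: cvgB; [exact: cvg_cst|exact: cvg_id]|exact: cvg_cst].
Qed.

Lemma continuous_expm_mul a b : continuous (fun u => (expm ((t - u) *: L) *m B) a b).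
Proof.
under eq_fun do rewrite mxE.
move=> u; apply: cvg_sumr => c; apply: cvgM; [exact: continuous_expm_entry|exact: cvg_cst].
Qed.

Lemma Rintegral_expm_mul k a b :
  \int[lebesgue_measure]_(u in `[0, t]) ((expm ((t - u) *: L) *m B) a b * cos (freq k * u)) =
  (phi_cos k t L *m B) a b.
Proof.
have cc : continuous (fun u : R => cos (freq k * u)).
  move=> x; apply: (@continuous_comp _ _ _ (fun u => freq k * u) cos); last exact: continuous_cos.
  by apply: cvgM; [exact: cvg_cst|exact: cvg_id].
under eq_Rintegral do rewrite mxE mulr_suml.
rewrite Rintegral_sumr => [||c]//.
  rewrite mxE; apply: eq_bigr => c _; rewrite mxE -RintegralZr//.
    by apply: eq_Rintegral => u _; rewrite mulrAC.
  apply: integrable_cont => u; apply: cvgM; [exact: continuous_expm_entry|exact: cc].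
apply: integrable_cont => u; apply: cvgM; last exact: cc.
by apply: cvgM; [exact: continuous_expm_entry|exact: cvg_cst].
Qed.

End Deterministic.

Section Approximation.
Context {d : measure_display} {T : measurableType d} {R : realType}.
Variables (P : probability T R) (n : nat) (F : R -> set (set T))
    (W : R -> T -> 'cV[R]_n) (Z : nat -> T -> 'cV[R]_n)
    (hF : filtration F) (hW : wiener_process P F W)
    (hZ : iid_standard_normal P Z) (hWZ : karhunen_loeve P W Z)
    (L B : 'M[R]_n) (hL : negative_semidefinite L) (X0 : 'cV[R]_n)
    (X : R -> T -> 'cV[R]_n) (hX : linear_sde_solution P F W L B X0 X)
    (t : R) (ht : t \in `[0, 1]).

Definition approx_moment2 K : R := enorm (expm (t *: L) *m X0) ^+ 2 +
  2 * \sum_(k < K) frobenius_norm (phi_cos k.+1 t L *m B) ^+ 2.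

Let x a : R := (expm (t *: L) *m X0) a 0.
Let c a k b : R := Num.sqrt 2 * (phi_cos k.+1 t L *m B) a b.
Let Zt k b (w : T) : R := Z k.+1 w b 0.

Let sZ k b : sqintble P (Zt k b). Proof. by have [] := iid_gauss hZ k b. Qed.
Let zZ k b : \int[P]_w Zt k b w = 0. Proof. by have [] := iid_gauss hZ k b. Qed.
Let oZ k b l e : \int[P]_w (Zt k b w * Zt l e w) = ((k == l) && (b == e))%:R.
Proof. exact: iid_orthonormal. Qed.

Lemma approx_moment2E K : \sum_a (x a ^+ 2 + \sum_(k < K) \sum_b c a k b ^+ 2) = approx_moment2 K.
Proof.
rewrite big_split/= -enorm_sqE /approx_moment2; congr (_ + _).
rewrite exchange_big mulr_sumr; apply: eq_bigr => k _ /=.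
rewrite /frobenius_norm sqr_sqrtr; last first.
  by apply: sumr_ge0 => i _; apply: sumr_ge0 => j _; exact: sqr_ge0.
rewrite mulr_sumr; apply: eq_bigr => a _; rewrite mulr_sumr; apply: eq_bigr => b _.
by rewrite exprMn sqr_sqrtr.
Qed.

Lemma expect_kl_approx K :
  ('E_P[fun w => (enorm (kl_approx L B X0 Z K t w) ^+ 2)%R] = (approx_moment2 K)%:E)%E.
Proof.
have E a : (fun w => kl_approx L B X0 Z K t w a 0) = fun w => x a + chaos Zt (c a) K w.
  apply/funext => w; rewrite /kl_approx !mxE summxE big_add1/= big_mkord -/(x a); congr (_ + _).
    by rewrite /x mxE.
  rewrite mulr_sumr; apply: eq_bigr => k _; rewrite mxE mulr_sumr; apply: eq_bigr => b _.
  by rewrite mulrA.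
rewrite expect_enorm; last first.
  by move=> a; rewrite E; apply: sqintbleD; [exact: sqintble_cst|exact: sqintble_chaos].
congr (_%:E); rewrite -approx_moment2E; apply: eq_bigr => a _.
by rewrite E moment2_cst_chaos.
Qed.

(** Mean-square convergence of the expansion of X_t entails convergence of the
    second moments of its partial sums. *)
Lemma expect_solution :
  exists2 v : R, approx_moment2 K @[K --> \oo] --> v &
  ('E_P[fun w => (enorm (X t w) ^+ 2)%R] = v%:E)%E.
Proof.
have t01 : 0 <= t <= 1 by move: ht; rewrite in_itv.
have hJ := ito_chaos hF hW hZ hWZ t01 (@continuous_expm_mul _ _ _ hL B t) (hX ht).
pose J a w := (X t w - expm (t *: L) *m X0) a 0.
have sJ a : sqintble P (J a) by have [] := hJ a.
have cJ a : moment2 P (fun w => J a w - chaos Zt (c a) K w) @[K --> \oo] --> (0 : R).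
  rewrite (_ : c a = fun k b => Num.sqrt 2 * \int[lebesgue_measure]_(u in `[0, t])
    ((expm ((t - u) *: L) *m B) a b * cos (freq k.+1 * u))); first exact: (hJ a).2.
  by apply/funext => k; apply/funext => b; rewrite (Rintegral_expm_mul hL).
have XE a : (fun w => X t w a 0) = fun w => x a + J a w.
  apply/funext => w; rewrite /J /x !mxE. by rewrite addrCA subrr addr0.
have sX a : sqintble P (fun w => X t w a 0).
  by rewrite XE; apply: sqintbleD => //; exact: sqintble_cst.
exists (\sum_a moment2 P (fun w => X t w a 0)); last exact: expect_enorm.
rewrite (_ : (fun K => _) = fun K => \sum_a moment2 P (fun w => x a + chaos Zt (c a) K w)); last first.
  apply/funext => K; rewrite -approx_moment2E; apply: eq_bigr => a _.
  by rewrite moment2_cst_chaos.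
apply: cvg_sumr => a.
apply: (@moment2_cvg _ _ _ P (fun w => X t w a 0) (fun K w => x a + chaos Zt (c a) K w)) => //.
  by move=> K; apply: sqintbleD; [exact: sqintble_cst|exact: sqintble_chaos].
have := cJ a; rewrite (_ : (fun N => _) = fun K => moment2 P (fun w => X t w a 0 - (x a + chaos Zt (c a) K w)))//.
apply/funext => K; apply: eq_moment2 => w; have /(congr1 (fun f => f w)) -> := XE a.
by rewrite opprD addrACA subrr add0r.
Qed.

Lemma moment2_error m :
  ('E_P[fun w => (enorm (X t w) ^+ 2)%R]
     - 'E_P[fun w => (enorm (kl_approx L B X0 Z m t w) ^+ 2)%R]
   = 2%R%:E * \sum_(m.+1 <= k <oo)
              (frobenius_norm (phi_cos k t L *m B) ^+ 2)%R%:E)%E.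
Proof.
have [v vlim ->] := expect_solution; rewrite expect_kl_approx -EFinB.
have H : \sum_(m.+1 <= k < K) frobenius_norm (phi_cos k t L *m B) ^+ 2
    @[K --> \oo] --> (v - approx_moment2 m) / 2.
  rewrite -(@cvg_shiftn (m.+1)).
  have -> : (fun K => \sum_(m.+1 <= k < K + m.+1) frobenius_norm (phi_cos k t L *m B) ^+ 2) =
     fun K => (approx_moment2 (K + m) - approx_moment2 m) / 2.
    apply/funext => K; rewrite /approx_moment2 opprD addrACA subrr add0r -mulrBr mulrC mulrA mulVf// mul1r.
    rewrite -!(big_mkord xpredT (fun k => frobenius_norm (phi_cos k.+1 t L *m B) ^+ 2)).
    rewrite (big_cat_nat (leq0n m) (leq_addl K m))/= addrAC subrr add0r.
    by rewrite big_add1 addnS.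
  apply: cvgM; last exact: cvg_cst.
  by apply: cvgB; [rewrite (@cvg_shiftn m)|exact: cvg_cst].
have -> : (\sum_(m.+1 <= k <oo) (frobenius_norm (phi_cos k t L *m B) ^+ 2)%R%:E =
    ((v - approx_moment2 m) / 2)%:E)%E.
  apply: cvg_lim => //; under eq_fun do rewrite sumEFin.
  exact: (cvg_comp _ _ H).
by rewrite -EFinM mulrC divfK.
Qed.

End Approximation.

Theorem theorem8 (R : realType) (d : measure_display) (T : measurableType d)
    (P : probability T R) (n : nat) (F : R -> set (set T))
    (W : R -> T -> 'cV[R]_n) (Z : nat -> T -> 'cV[R]_n)
    (hF : filtration F) (hW : wiener_process P F W)
    (hZ : iid_standard_normal P Z) (hWZ : karhunen_loeve P W Z)
    (L B : 'M[R]_n) (hL : negative_semidefinite L) (X0 : 'cV[R]_n)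
    (X : R -> T -> 'cV[R]_n) (hX : linear_sde_solution P F W L B X0 X)
    (t : R) (ht : t \in `[0, 1]) (m : nat) (hm : (2 <= m)%N) :
  ('E_P[fun w => (enorm (X t w) ^+ 2)%R]
     - 'E_P[fun w => (enorm (kl_approx L B X0 Z m t w) ^+ 2)%R]
   = 2%R%:E * \sum_(m.+1 <= k <oo)
              (frobenius_norm (phi_cos k t L *m B) ^+ 2)%R%:E)%E
  /\
  (2%R%:E * \sum_(m.+1 <= k <oo) (frobenius_norm (phi_cos k t L *m B) ^+ 2)%R%:E
   <= (2 * spectral_norm B ^+ 2 / pi ^+ 2 * (n%:R / (m%:R - 1)))%R%:E)%E.
Proof.
split; first exact: (moment2_error hF hW hZ hWZ hL hX ht).
by apply: tail_phi_cos_le => //; move: ht; rewrite in_itv => /andP[].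
Qed.
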